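(* Let $\alpha>0$ be given, let $a,U>0$, let $\Sigma\subset(0,U]$, assume that $m\log(d)\le n\le m_1m_2$ and that the noise satisfies the noise assumption stated in the context. Let $C_n=C_n(Y,\alpha)$ be the set defined in the context (it does not depend on $\sigma$). Then for every $M_0\in\mathcal A(a,m)$ and every $\sigma\in\Sigma$, $$\mathbb P_{M_0,\sigma}\left(M_0\in C_n\right)\ge 1-\alpha .$$ Hence, for any $\alpha'>2/d+\exp\left(-n^2/(372\,m_1m_2)\right)$ and any $1\le k_0<k\le m$, $C_n$ is an honest confidence set at level $\alpha$ for the model $\mathcal A(a,k)\otimes\Sigma$ that adapts, up to a log-factor, to the sub-model $\mathcal A(a,k_0)\otimes\Sigma$ at level $\alpha'$; that is, there is a constant $K>0$ depending only on $\alpha,\alpha',a,U$ such that for both $l=k_0$ and $l=k$ $$\sup_{(M_0,\sigma)\in\mathcal A(a,l)\otimes\Sigma}\mathbb P_{M_0,\sigma}\left(\frac{|C_n|_F^2}{m_1m_2}>K\,\frac{l\,d\log(d)}{n}\right)\le\alpha' .$$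
   Context: Notation. $m_1,m_2\in\mathbb N$, $m=\min(m_1,m_2)$, $d=m_1+m_2$. $\|\cdot\|_F$ is the Frobenius norm, $\|A\|_\infty=\max_{i,j}|A_{ij}|$, $\langle A,B\rangle=\mathrm{tr}(A^TB)$, $|S|_F=\sup\{\|x-y\|_F:x,y\in S\}$. $\mathcal A(a,k)=\{A\in\mathbb R^{m_1\times m_2}:\|A\|_\infty\le a,\ \mathrm{rank}(A)\le k\}$ and $\mathcal A(a,k)\otimes\Sigma=\{(A,\sigma):A\in\mathcal A(a,k),\sigma\in\Sigma\}$. Trace regression model. One observes $(X_i,Y_i)$, $i=1,\dots,n$, with $Y_i=\langle X_i,M_0\rangle+\epsilon_i$, where $X_1,\dots,X_n$ are i.i.d. uniform on $\{e_j(m_1)e_k(m_2)^T:1\le j\le m_1,1\le k\le m_2\}$ ($e_j(s)$ the canonical basis vectors of $\mathbb R^s$) and are independent of the noise $(\epsilon_i)$. $\mathbb P_{M_0,\sigma}$ is the law of the data, with matrix $M_0$ and noise variance $\sigma^2$. The number $n$ is assumed even. Noise assumption: the $\epsilon_i$ are independent, $\mathbb E\epsilon_i=0$, $\mathbb E\epsilon_i^2=\sigma^2$, and $\max_i|\epsilon_i|\le U$ almost surely. Preliminary estimator. $\hat M$ is an estimator computed only from the second half sample $(X_i,Y_i)_{n/2<i\le n}$, not using knowledge of $\sigma$, such that $\|\hat M\|_\infty\le a$ and such that, for a constant $C_0=C_0(a,U)$, every $1\le k\le m$, every $M_0\in\mathcal A(a,k)$ and every $\sigma\in\Sigma$: $\mathbb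 P_{M_0,\sigma}\big(\|\hat M-M_0\|_F^2/(m_1m_2)\le C_0\,kd\log(d)/n\big)\ge 1-2/d$. (The constrained matrix Lasso of Klopp, with $\sigma$ replaced by its upper bound $U$, has this property when $m\log d\le n\le d^2\log d$, by earlier work.) Construction of $C_n$. For each entry $(i,j)$, let $a_1<\dots<a_{p_{(i,j)}}$ be the indices $l\in\{1,\dots,n/2\}$ with $X_l=e_i(m_1)e_j(m_2)^T$, and form the $\lfloor p_{(i,j)}/2\rfloor$ disjoint pairs $(a_1,a_2),(a_3,a_4),\dots$. Let $N$ be the total number of pairs obtained over all entries $(i,j)$. Enumerate the pairs as $k=1,\dots,N$; for the $k$-th pair $(l,s)$ put $\tilde X_k=X_l=X_s$, $Z_k=Y_l$, $Z_k'=Y_s$. Define $$\hat R_N=\frac1N\sum_{k=1}^N\big(Z_k-\langle\hat M,\tilde X_k\rangle\big)\big(Z_k'-\langle\hat M,\tilde X_k\rangle\big)\quad(\hat R_N=0\text{ if }N=0),$$ $$z_{\alpha,N}=\frac{U^2+4a^2}{\sqrt{N\alpha}}\ \text{ if }N\ne0,\qquad z_{\alpha,0}=4a^2,$$ $$C_n=\Big\{A\in\mathcal A(a,m):\ \frac{\|A-\hat M\|_F^2}{m_1m_2}\le\hat R_N+z_{\alpha,N}\Big\}.$$ *)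

(* Defs.v *)
From HB Require Import structures.
From mathcomp Require Import all_boot all_order all_algebra.
From mathcomp Require Import all_classical all_reals all_analysis.

Set Implicit Arguments.
Unset Strict Implicit.
Unset Printing Implicit Defensive.
Import Order.TTheory GRing.Theory Num.Theory.
Import numFieldNormedType.Exports.
Local Open Scope classical_set_scope.
Local Open Scope ring_scope.

                                                                        
                                               
Definition measure_mx_display : measure_display -> measure_display.
Proof. exact. Qed.

Section measurable_matrix.
Context {d} {T : measurableType d} {m n : nat}.

Definition mx_entries_measurable : set (set 'M[T]_(m, n)) :=
  <<s \bigcup_(ij in [set: 'I_m * 'I_n])
        preimage_set_system setT (fun A : 'M[T]_(m, n) => A ij.1 ij.2)
          measurable >>.

Let mx_set0 : mx_entries_measurable set0.
Proof. exact: sigma_algebra0. Qed.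

Let mx_setC A : mx_entries_measurable A -> mx_entries_measurable (~` A).
Proof. exact: sigma_algebraC. Qed.

Let mx_bigcup (F : (set 'M[T]_(m, n))^nat) :
  (forall i, mx_entries_measurable (F i)) ->
  mx_entries_measurable (\bigcup_i F i).
Proof. exact: sigma_algebra_bigcup. Qed.

HB.instance Definition _ := @isMeasurable.Build (measure_mx_display d)
  'M[T]_(m, n) mx_entries_measurable mx_set0 mx_setC mx_bigcup.

End measurable_matrix.

Definition mx_inner (R : realType) (m1 m2 : nat) (A B : 'M[R]_(m1, m2)) : R :=
  \tr (A^T *m B).

Definition frobenius (R : realType) (m1 m2 : nat) (A : 'M[R]_(m1, m2)) : R :=
  Num.sqrt (mx_inner A A).

                                                                            
                           
Definition frobenius_diam (R : realType) (m1 m2 : nat)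
    (S : set 'M[R]_(m1, m2)) : R :=
  sup [set frobenius (A - B) | A in S & B in S].

                                                                             
                  
Definition low_rank (R : realType) (m1 m2 : nat) (a : R) (k : nat) :
    set 'M[R]_(m1, m2) :=
  [set A | `|A| <= a /\ (\rank A <= k)%N].

Definition mutually_independent d (Omega : measurableType d) (R : realType)
    (P : probability Omega R) d' (T : measurableType d') (n : nat)
    (V : 'I_n -> {RV P >-> T}) : Prop :=
  forall (J : {set 'I_n}) (B : 'I_n -> set T),
    (forall i, measurable (B i)) ->
    P (\bigcap_(i in [set` J]) (V i @^-1` B i)) =
      (\prod_(i in J) P (V i @^-1` B i))%E.

Definition families_independent d (Omega : measurableType d) (R : realType)
    (P : probability Omega R) d1 (T1 : measurableType d1)
    d2 (T2 : measurableType d2) (n : nat)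
    (V : 'I_n -> {RV P >-> T1}) (W : 'I_n -> {RV P >-> T2}) : Prop :=
  forall (A : set (n.-tuple T1)) (B : set (n.-tuple T2)),
    measurable A -> measurable B ->
    P [set w | A [tuple V i w | i < n] /\ B [tuple W i w | i < n]] =
      (P [set w | A [tuple V i w | i < n]] *
       P [set w | B [tuple W i w | i < n]])%E.

Record experiment (R : realType) (m1 m2 n : nat) := Experiment {
  exp_disp : measure_display;
  exp_space : measurableType exp_disp;
  exp_prob : probability exp_space R;
  design : 'I_n -> {RV exp_prob >-> 'M[R]_(m1, m2)};
  noise : 'I_n -> {RV exp_prob >-> R} }.

Record trace_regression (R : realType) (m1 m2 n : nat) (U sigma : R)
    (E : experiment R m1 m2 n) : Prop := {
  design_uniform : forall i j k,
    exp_prob E (design E i @^-1` [set delta_mx j k]) = ((m1 * m2)%:R^-1)%:E;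
  design_independent : mutually_independent (design E);
  noise_independent : mutually_independent (noise E);
  design_noise_independent : families_independent (design E) (noise E);
  noise_centered : forall i, ('E_(exp_prob E)[noise E i])%E = 0%E;
  noise_variance : forall i,
    ('E_(exp_prob E)[fun w => (noise E i w ^+ 2)%R])%E = (sigma ^+ 2)%:E;
  noise_bounded :
    {ae exp_prob E, forall w, forall i, `|noise E i w| <= U} }.

Definition response (R : realType) (m1 m2 n : nat) (E : experiment R m1 m2 n)
    (M0 : 'M[R]_(m1, m2)) (i : 'I_n) (w : exp_space E) : R :=
  mx_inner (design E i w) M0 + noise E i w.

Definition sample (R : realType) (m1 m2 n : nat) (E : experiment R m1 m2 n)
    (M0 : 'M[R]_(m1, m2)) (w : exp_space E) : n.-tuple ('M[R]_(m1, m2) * R) :=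
  [tuple (design E i w, response M0 i w) | i < n].

Definition second_half (T : Type) (n : nat) (s : n.-tuple T) :
    (n - n./2).-tuple T :=
  [tuple of drop n./2 s].

                                                                               
                                                                             
                         
Notation half_estimator R m1 m2 n :=
  {mfun (n - n./2).-tuple ('M[R]_(m1, m2) * R)%type >-> 'M[R]_(m1, m2)}.

                                                                              
                                                                              
                                                                         
Definition model (R : realType) (m1 m2 n : nat) :=
  'M[R]_(m1, m2) -> R -> experiment R m1 m2 n.

Definition rate (R : realType) (m1 m2 n k : nat) : R :=
  k%:R * (m1 + m2)%:R * ln (m1 + m2)%:R / n%:R.

Definition preliminary_estimator (R : realType) (m1 m2 n : nat) (a C0 : R)
    (Sigma : set R) (E : model R m1 m2 n) (Mhat : half_estimator R m1 m2 n) :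
    Prop :=
  (forall s, `|Mhat s| <= a) /\
  (forall (k : nat) (M0 : 'M[R]_(m1, m2)) (sigma : R),
    (1 <= k <= minn m1 m2)%N -> low_rank a k M0 -> Sigma sigma ->
    ((1 - 2 / (m1 + m2)%:R)%:E <=
       exp_prob (E M0 sigma)
         [set w | frobenius (Mhat (second_half (sample M0 w)) - M0) ^+ 2
                    / (m1 * m2)%:R <= C0 * rate R m1 m2 n k]%R)%E).

Fixpoint consecutive_pairs (T : Type) (s : seq T) : seq (T * T) :=
  if s is x :: y :: s' then (x, y) :: consecutive_pairs s' else [::].

Section confidence_set.
Context (R : realType) (m1 m2 n : nat).
Implicit Type s : n.-tuple ('M[R]_(m1, m2) * R).

Definition observations_at s (jk : 'I_m1 * 'I_m2) : seq 'I_n :=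
  [seq l : 'I_n <- enum 'I_n | (l < n./2)%N & (tnth s l).1 == delta_mx jk.1 jk.2].

Definition sample_pairs s : seq ('I_n * 'I_n) :=
  flatten [seq consecutive_pairs (observations_at s jk)
          | jk <- enum {: 'I_m1 * 'I_m2}].

Definition residual (A : 'M[R]_(m1, m2)) (xy : 'M[R]_(m1, m2) * R) : R :=
  xy.2 - mx_inner A xy.1.

Definition Rhat (Mhat : half_estimator R m1 m2 n) s : R :=
  let N := size (sample_pairs s) in
  let M := Mhat (second_half s) in
  if N == 0%N then 0 else
  N%:R^-1 * \sum_(p <- sample_pairs s)
              residual M (tnth s p.1) * residual M (tnth s p.2).

Definition zthreshold (a U alpha : R) (N : nat) : R :=
  if N == 0%N then 4 * a ^+ 2
  else (U ^+ 2 + 4 * a ^+ 2) / Num.sqrt (N%:R * alpha).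

Definition confidence_set (a U alpha : R) (Mhat : half_estimator R m1 m2 n) s :
    set 'M[R]_(m1, m2) :=
  [set A | low_rank a (minn m1 m2) A /\
    frobenius (A - Mhat (second_half s)) ^+ 2 / (m1 * m2)%:R <=
      Rhat Mhat s + zthreshold a U alpha (size (sample_pairs s))].

Definition honest (a alpha : R) (k : nat) (Sigma : set R) (E : model R m1 m2 n)
    (C : n.-tuple ('M[R]_(m1, m2) * R) -> set 'M[R]_(m1, m2)) : Prop :=
  ((1 - alpha)%:E <=
    ereal_inf [set exp_prob (E t.1 t.2) [set w | C (sample t.1 w) t.1]
              | t in low_rank a k `*` Sigma])%E.

Definition diam_controlled (a alpha' K : R) (l : nat) (Sigma : set R)
    (E : model R m1 m2 n)
    (C : n.-tuple ('M[R]_(m1, m2) * R) -> set 'M[R]_(m1, m2)) : Prop :=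
  (ereal_sup [set exp_prob (E t.1 t.2)
                    [set w | K * rate R m1 m2 n l <
                       frobenius_diam (C (sample t.1 w)) ^+ 2 / (m1 * m2)%:R]%R
             | t in low_rank a l `*` Sigma] <= alpha'%:E)%E.

End confidence_set.

(* Main.v *)
Require Import Defs.
From HB Require Import structures.
From mathcomp Require Import all_boot all_order all_algebra.
From mathcomp Require Import all_classical all_reals all_analysis.
From mathcomp Require Import measurable_realfun.
From mathcomp Require Import fingroup perm.
From mathcomp Require Import ring lra zify.

Set Implicit Arguments.
Unset Strict Implicit.
Unset Printing Implicit Defensive.
Import Order.TTheory GRing.Theory Num.Theory.
Import numFieldNormedType.Exports.
Local Open Scope ring_scope.

(** Write h = n/2, D = m1 m2, and fix the second half of the sample, hence the
    estimator M.  For a cell c let g(c) = (M0 - M)_c^2 and let r be the mean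
    of g over the D cells, that is, the normalised loss of M.  If p_c
    observations of the first half fall in cell c, then N = sum_c [p_c/2]
    pairs are formed, where [p_c/2] is an integer part, and

      N (R - r) = sum_c [p_c/2] (g(c) - r) + sum over the pairs of
                  gap (e + e') + e e',

    where e, e' are the noises of the two members of a pair, gap is the entry
    of M0 - M in their cell, and R is the averaged product of residuals.
    Everything rests on the bound E[N (R - r)^2] <= B^2, B = U^2 + 4 a^2, and
    on Chebyshev's inequality ([prob_deviation]).

    The noise sum.  The pairs use disjoint indices and M does not involve the
    first half, so its terms are orthogonal, to one another and to the first
    sum, and each has second moment 2 sigma^2 gap^2 + sigma^4
    ([mean_pairs_sq]).  This contributes at most 8 a^2 U^2 + U^4.

    The design sum.  The labels of the pairs are not independent given N.
    They are exchangeable, though, and the weights g(c) - r sum to zero;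
    therefore the cross terms c <> c' contribute at most zero and only
    D^-1 sum_c (g(c) - r)^2, at most 4 a^4, times E[sum_c [p_c/2]^2 / N]
    remains ([sum_centered_sq_le]).  The last expectation is at most 2: its
    excess over 1 comes from cells with p_c >= 4, and redrawing two
    coincident observations jointly shows that such crowding is rare even
    after division by N ([sum_crowded_le]).

    Coverage follows: either N = 0, where the radius 4 a^2 suffices, or M0 is
    missed only if N (R - r)^2 > B^2 / alpha ([prob_coverage]).

    For the diameter, the set lies in a Frobenius ball, so the squared
    diameter is at most 4 D (R + z).  Here r is at most C0 times the rate
    outside an event of probability at most 2/d, where d = m1 + m2, and R - r
    and z are of order N^(-1/2).  The redrawing argument also gives
    E[1/(N + 1)] <= 14 D / h^2, so N is at least of order n^2/D with
    probability close to one ([prob_few_pairs]).  Since D <= d^2, N^(-1/2) is then at most a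
    constant times the rate.  The three exceptional events have total
    probability at most 3 alpha'/4 as soon as d and n^2/D exceed constants
    that depend on alpha' only.  Otherwise the rate itself is bounded below by
    such a constant, and the trivial bound 4 a^2 on the normalised squared
    diameter is enough ([prob_large_diam]).

    Probabilities in the model concern measurable sets only.  The diameter
    event is measurable because the set is the intersection of a ball with
    the box of bounded matrices, centred at a point of the box: truncated
    rational matrices are dense in it unless it is empty or a single point
    ([measurable_confidence_diam]). *)

(** * Pairs of equal labels in a uniformly random labelling *)

Section Cells.
Variables (C : finType) (n : nat) (I : {set 'I_n}).
Implicit Types (x y : {ffun 'I_n -> C}) (c : C) (i j l : 'I_n).

Definition hits x c : nat := #|[set l in I | x l == c]|.
Definition pairs_at x c : nat := (hits x c)./2.
Definition pair_total x : nat := (\sum_c pairs_at x c)%N.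

(** The new labels [c] and [c'] of [i] and [j] are allowed to differ, so that
    the pair of old labels and the pair of new ones can be exchanged. *)
Definition recolor2 i j x c c' : {ffun 'I_n -> C} :=
  [ffun l => if l == i then c else if l == j then c' else x l].

(** Counts that ignore [i] and [j], hence are unaffected by their labels. *)
Definition hits_off i j x c : nat :=
  #|[set l in I | [&& l != i, l != j & x l == c]]|.

Definition pair_total_off i j x : nat := (\sum_c (hits_off i j x c)./2)%N.

Lemma hits_recolor i j x c c' : i != j -> i \in I -> j \in I ->
  hits (recolor2 i j x c c) c' = (hits_off i j x c' + (c == c').*2)%N.
Proof.
move=> ij iI jI; rewrite /hits /hits_off.
have -> : [set l in I | recolor2 i j x c c l == c'] =
   [set l in I | [&& l != i, l != j & x l == c']] :|:
   (if c == c' then [set i; j] else finset.set0).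
  apply/setP => l; rewrite !inE ffunE.
  case: (eqVneq l i) => [->|li] /=.
    by rewrite iI /=; case: eqP => // _; rewrite !inE ?eqxx.
  case: (eqVneq l j) => [->|lj] /=.
    by rewrite jI /=; case: eqP => // _; rewrite !inE ?eqxx ?orbT.
  by case: (c == c'); rewrite !inE ?(negPf li) ?(negPf lj) ?orbF.
rewrite cardsU disjoint_setI0; last first.
  apply/pred0P => l /=; rewrite !inE; case: (c == c'); rewrite !inE ?andbF //.
  by case: (eqVneq l i) => [->|li]; rewrite ?andbF //; case: (eqVneq l j); rewrite ?andbF.
rewrite cards0 subn0; case: (c == c'); last by rewrite cards0.
by rewrite cards2 ij.
Qed.

(** Two further observations of one cell add one pair whatever the parity of
    the count in that cell; this is why two observations are redrawn and not
    one. *)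
Lemma pair_total_recolor i j x c : i != j -> i \in I -> j \in I ->
  pair_total (recolor2 i j x c c) = (pair_total_off i j x).+1.
Proof.
move=> ij iI jI; rewrite /pair_total /pair_total_off.
under eq_bigr => c' _ do
  rewrite /pairs_at hits_recolor // halfD odd_double andbF add0n doubleK.
rewrite big_split /= -addn1; congr addn.
by rewrite (bigD1 c) //= eqxx big1 ?addn0 // => c' /negPf; rewrite eq_sym => ->.
Qed.

Lemma pair_total_off_le i j x : (pair_total_off i j x <= pair_total x)%N.
Proof.
apply: leq_sum => c _; apply: half_leq; apply: subset_leq_card.
by apply/fintype.subsetP => l; rewrite !inE => /andP[-> /and3P[_ _ ->]].
Qed.

Lemma card_twice_hit_off i j x :
  (#|[set c | 2 <= hits_off i j x c]| <= pair_total_off i j x)%N.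
Proof.
rewrite -sum1_card big_mkcond /=; apply: leq_sum => c _; rewrite inE.
by case: (hits_off i j x c) => [|[|k]].
Qed.

Lemma hits_le x c : (hits x c <= #|I|)%N.
Proof. by apply: subset_leq_card; apply/fintype.subsetP => l; rewrite inE => /andP[]. Qed.

(** Links sums over cells to sums over pairs of observations, to which the
    redrawing applies. *)
Lemma sum_coincidences (x : {ffun 'I_n -> C}) (P : pred C) :
  (\sum_(i in I) \sum_(j in I | j != i) (x i == x j) && P (x i) =
   \sum_(c | P c) hits x c * (hits x c).-1)%N.
Proof.
rewrite (partition_big x predT) //= [RHS]big_mkcond /=; apply: eq_bigr => c _.
have E i : (i \in I) && (x i == c) ->
    (\sum_(j in I | j != i) (x i == x j) && P (x i))%N =
    (if P c then (hits x c).-1 else 0)%N.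
  move=> /andP[iI /eqP xi]; rewrite xi.
  case: (P c); last by rewrite big1 // => j _; rewrite andbF.
  have <- : #|[set l in I | x l == c] :\ i| = (hits x c).-1.
    rewrite /hits (cardsD1 i [set l in I | x l == c]).
    by rewrite [in RHS]inE iI xi eqxx.
  rewrite -sum1_card [RHS]big_mkcond /= [LHS]big_mkcond /=; apply: eq_bigr => j _.
  rewrite !inE andbT (eq_sym c).
  by case: (j == i); case: (j \in I); case: (x j == c).
rewrite (eq_bigr _ E) sum_nat_const.
have -> : #|[pred i | (i \in I) && (x i == c)]| = hits x c.
  by apply: eq_card => i; rewrite !inE.
by case: (P c); rewrite ?muln0.
Qed.


Section Weighted.
Variable R : realFieldType.
Local Notation D := (#|C|%:R : R).
Local Notation N x := ((pair_total x)%:R : R).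
Local Notation X := ({ffun 'I_n -> C}).

(** Redrawing the labels of [i] and [j] preserves the uniform law: exchanging
    the old pair of labels with the new one is an involution. *)
Lemma sum_resample2 (G : X -> R) i j : i != j ->
  D ^+ 2 * (\sum_x G x) = \sum_x \sum_c \sum_c' G (recolor2 i j x c c').
Proof.
move=> ij.
under [RHS]eq_bigr => x _ do rewrite pair_bigA /=.
rewrite pair_bigA /=.
pose s (p : X * (C * C)) := (recolor2 i j p.1 p.2.1 p.2.2, (p.1 i, p.1 j)).
have ss : involutive s.
  move=> [x [c c']]; rewrite /s /= !ffunE eqxx eq_sym (negPf ij) eqxx.
  congr (_, _); apply/ffunP => l; rewrite !ffunE.
  by case: eqVneq => [->//|_]; case: eqVneq => [->|].
rewrite [RHS](reindex_inj (inv_inj ss)) /=.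
transitivity (\sum_(p : X * (C * C)) G p.1).
  rewrite -(pair_bigA _ (fun x (_ : C * C) => G x)) /= mulr_sumr.
  apply: eq_bigr => x _; rewrite sumr_const card_prod.
  by rewrite expr2 -natrM mulr_natl.
apply: eq_bigr => -[x [c c']] _ /=; congr G; apply/ffunP => l; rewrite !ffunE.
by case: eqVneq => [->//|_]; case: eqVneq => [->|].
Qed.

(** Given that [i] and [j] have the same label, this label is uniform and
    independent of the other labels. *)
Lemma sum_resample_eq (G : X -> R) i j : i != j ->
  D ^+ 2 * (\sum_(x : X) (x i == x j)%:R * G x) = \sum_x \sum_c G (recolor2 i j x c c).
Proof.
move=> ij; rewrite (sum_resample2 _ ij); apply: eq_bigr => x _.
apply: eq_bigr => c _; rewrite (bigD1 c) //= big1 ?addr0 => [|c' cc'].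
  by rewrite !ffunE eqxx (eq_sym j) (negPf ij) !eqxx mul1r.
by rewrite !ffunE eqxx (eq_sym j) (negPf ij) eqxx eq_sym (negPf cc') mul0r.
Qed.

(** After redrawing, the label must be one of those that occur at least twice
    among the remaining observations. There are at most as many of these as
    pairs among the remaining observations, so division by the number of pairs
    leaves at most one. *)
Lemma sum_crowded_le i j : i != j -> i \in I -> j \in I ->
  D ^+ 2 * (\sum_(x : X) ((x i == x j) && (4 <= hits x (x i))%N)%:R / N x) <=
  #|X|%:R.
Proof.
move=> ij iI jI.
under eq_bigr => x _ do rewrite -mulnb natrM -mulrA.
rewrite sum_resample_eq // -sum1_card natr_sum; apply: ler_sum => x _.
under eq_bigr => c _.
  rewrite ffunE eqxx hits_recolor // eqxx pair_total_recolor // addn2 !ltnS; over.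
rewrite -mulr_suml ler_pdivrMr ?ltr0n // mul1r -natr_sum ler_nat.
apply: leqW; apply: leq_trans (card_twice_hit_off i j x).
rewrite -sum1_card [leqRHS]big_mkcond /=; apply: leq_sum => c _.
by rewrite inE; case: leqP.
Qed.

(** Converse use of the same redrawing: a coincidence creates at most one pair
    more than there are without it. Combined with an upper bound on
    coincidences per pair, it forces many pairs. *)
Lemma sum_coincidence_ge i j : i != j -> i \in I -> j \in I ->
  \sum_x (N x + 1)^-1 <= D * (\sum_(x : X) (x i == x j)%:R / N x).
Proof.
move=> ij iI jI.
have [D0|D0] := posnP #|C|.
  rewrite D0 mul0r big1 // => x _; have := card0_eq D0 (x i); by rewrite inE.
have D0' : 0 < D by rewrite ltr0n.
rewrite -(ler_pM2l D0') [leRHS]mulrA -expr2 sum_resample_eq // mulr_sumr.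
apply: ler_sum => x _.
under eq_bigr => c _ do rewrite pair_total_recolor //.
rewrite sumr_const -[leRHS]mulr_natl ler_pM2l // natr1.
by rewrite lef_pV2 ?posrE ?ltr0n // ler_nat ltnS pair_total_off_le.
Qed.

(** Sum of [sum_crowded_le] over the pairs of indices. At most [#|C| ^ 2] of
    them exist, which offsets the factor [D ^ 2] there. *)
Lemma sum_crowded_all : (#|I| <= #|C|)%N ->
  \sum_x (\sum_(c | (4 <= hits x c)%N) (hits x c * (hits x c).-1)%:R) / N x
    <= #|X|%:R.
Proof.
move=> IC.
have [I0|I0] := posnP #|I|.
  rewrite big1 // => x _; rewrite big1 ?mul0r // => c.
  by have := hits_le x c; rewrite I0; lia.
have D0 : 0 < D ^+ 2 by rewrite exprn_gt0 // ltr0n; lia.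
rewrite -(ler_pM2l D0).
under eq_bigr => x _.
  rewrite -natr_sum -(sum_coincidences x (fun c => 4 <= hits x c)%N).
  rewrite natr_sum mulr_suml.
  under eq_bigr => i _ do rewrite natr_sum mulr_suml.
  over.
rewrite exchange_big /=.
under eq_bigr => i _ do rewrite exchange_big /=.
rewrite mulr_sumr.
apply: (@le_trans _ _ (\sum_(i in I) \sum_(j in I) #|X|%:R)).
  apply: ler_sum => i iI; rewrite mulr_sumr.
  rewrite [leRHS](bigD1 i) //= -[leLHS]add0r; apply: lerD => //.
  by apply: ler_sum => j /andP[jI ij]; apply: sum_crowded_le => //; rewrite eq_sym.
under eq_bigr => i _ do rewrite sumr_const.
rewrite sumr_const -[leLHS]mulr_natl -[X in _ * X]mulr_natl mulrA.
rewrite ler_wpM2r // expr2 -!natrM ler_nat.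
exact: leq_mul.
Qed.

(** A cell with [k] pairs contributes [k ^ 2 = k + k (k - 1)]; the terms [k]
    add up to the number of pairs, and the excess is nonzero only if the cell
    has at least four observations. *)
Lemma sum_pairs_sq_le : (#|I| <= #|C|)%N ->
  \sum_x (\sum_c (pairs_at x c)%:R ^+ 2) / N x <= 2 * #|X|%:R.
Proof.
move=> IC.
rewrite mulr_natl mulr2n; apply: le_trans (lerD (lexx _) (sum_crowded_all IC)).
rewrite -sum1_card natr_sum -big_split /=; apply: ler_sum => x _.
have [N0|N0] := posnP (pair_total x).
  by rewrite N0 invr0 !mulr0 addr0.
have N0' : 0 < N x by rewrite ltr0n.
rewrite ler_pdivrMr // mulrDl divfK ?gt_eqF // mul1r.
under eq_bigr => c _ do rewrite -natrX.
rewrite -!natr_sum -natrD ler_nat.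
rewrite [X in (_ <= _ + X)%N]big_mkcond /= -big_split /=; apply: leq_sum => c _.
rewrite /pairs_at; set p := hits x c; case: leqP => p4.
  by case: p p4 => [|[|[|[|]]]].
have -> : (p = odd p + p./2 + p./2)%N by rewrite -{1}(odd_double_half p); lia.
set k := p./2; have : (2 <= k)%N by rewrite /k -[2%N]/(4./2); apply: half_leq.
rewrite halfD; case: (odd p) => /=; rewrite ?oddD; nia.
Qed.

(** The coincidences in a cell with two or three observations number at most
    six times its pairs; crowded cells are handled by [sum_crowded_all]. *)
Lemma sum_inv_pair_total_le : (#|I| <= #|C|)%N ->
  \sum_x (N x + 1)^-1 * (#|I| * #|I|.-1)%:R <= 7 * D * #|X|%:R.
Proof.
move=> IC.
apply: (@le_trans _ _ (D * \sum_x (\sum_c (hits x c * (hits x c).-1)%:R) / N x)).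
  have -> : \sum_x (N x + 1)^-1 * (#|I| * #|I|.-1)%:R =
    \sum_(i in I) \sum_(j in I | j != i) \sum_x (N x + 1)^-1.
    rewrite -mulr_suml.
    under [RHS]eq_bigr => i iI.
      rewrite sumr_const.
      have -> : #|[pred j | (j \in I) && (j != i)]| = #|I|.-1.
        rewrite (cardsD1 i I) iI; apply: eq_card => j; by rewrite !inE andbC.
      over.
    by rewrite sumr_const -mulrnA mulr_natr mulnC.
  have -> : \sum_x (\sum_c (hits x c * (hits x c).-1)%:R) / N x =
     \sum_(i in I) \sum_(j in I | j != i) \sum_(x : X) (x i == x j)%:R / N x.
    under [LHS]eq_bigr => x _.
      rewrite -natr_sum -(sum_coincidences x predT).
      rewrite natr_sum mulr_suml.
      under eq_bigr => i _ do rewrite natr_sum mulr_suml.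
      over.
    rewrite exchange_big /=; apply: eq_bigr => i _.
    rewrite exchange_big /=; apply: eq_bigr => j _.
    by apply: eq_bigr => x _; rewrite andbT.
  rewrite mulr_sumr; apply: ler_sum => i iI.
  rewrite mulr_sumr; apply: ler_sum => j /andP[jI ij].
  by apply: sum_coincidence_ge => //; rewrite eq_sym.
rewrite [7 * D]mulrC -mulrA ler_wpM2l //.
have -> : 7 * #|X|%:R = 6 * #|X|%:R + #|X|%:R :> R by ring.
apply: le_trans (lerD (lexx _) (sum_crowded_all IC)).
rewrite -sum1_card natr_sum mulr_sumr -big_split /=; apply: ler_sum => x _.
have [N0|N0] := posnP (pair_total x).
  by rewrite N0 invr0 !mulr0 addr0 mulr1 ler0n.
have N0' : 0 < N x by rewrite ltr0n.
rewrite ler_pdivrMr // mulrDl divfK ?gt_eqF // mulr1.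
rewrite -!natr_sum -natrM -natrD ler_nat big_distrr /=.
rewrite [X in (_ <= _ + X)%N]big_mkcond /= -big_split /=; apply: leq_sum => c _.
rewrite /pairs_at; set p := hits x c; case: leqP => p4.
  by case: p p4 => [|[|[|[|]]]].
by rewrite leq_addl.
Qed.

(** Mixed moment of the numbers of pairs in two cells, weighted by the inverse
    of the total number of pairs, up to the factor [#|X|]. *)
Definition cross_moment c c' : R :=
  \sum_x (pairs_at x c * pairs_at x c')%:R / N x.

Lemma hits_perm (s : {perm C}) x c : hits [ffun l => s (x l)] (s c) = hits x c.
Proof.
by apply: eq_card => l; rewrite !inE ffunE (inj_eq perm_inj).
Qed.

(** The total number of pairs is invariant under relabelling the cells. *)
Lemma cross_moment_perm (s : {perm C}) c c' :
  cross_moment (s c) (s c') = cross_moment c c'.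
Proof.
pose f x : X := [ffun l => s (x l)].
have fI : injective f.
  by move=> x y /ffunP e; apply/ffunP => l; have := e l; rewrite !ffunE => /perm_inj.
rewrite /cross_moment (reindex_inj fI) /=; apply: eq_bigr => x _.
rewrite /pairs_at !hits_perm; congr (_ / _%:R).
rewrite /pair_total (reindex_inj (@perm_inj _ s)) /=; apply: eq_bigr => e _.
by rewrite /pairs_at hits_perm.
Qed.

Lemma cross_moment_diag c c' : cross_moment c c = cross_moment c' c'.
Proof. by rewrite -{1 2}(tpermR c c') cross_moment_perm. Qed.

(** The permutations of the cells act doubly transitively. *)
Lemma cross_moment_offdiag c c' e e' : c != c' -> e != e' ->
  cross_moment c c' = cross_moment e e'.
Proof.
move=> cc' ee'; pose s := (tperm c e * tperm (tperm c e c') e')%g.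
rewrite -(cross_moment_perm s) /s !permM tpermL tpermL tpermD //; last by rewrite eq_sym.
by rewrite -[X in _ != X](tpermL c e) (inj_eq perm_inj) eq_sym.
Qed.

Lemma cross_moment_ge0 c c' : 0 <= cross_moment c c'.
Proof. by apply: sumr_ge0 => x _; rewrite divr_ge0. Qed.

(** Expanding the square leaves one diagonal moment [s] and one off-diagonal
    moment [t >= 0]. For weights of sum zero the quadratic form is [(s - t)]
    times the sum of the squared weights, and [D * s] is controlled by
    [sum_pairs_sq_le]. *)
Lemma sum_centered_sq_le (b : C -> R) : (#|I| <= #|C|)%N -> \sum_c b c = 0 ->
  D * (\sum_x (\sum_c b c * (pairs_at x c)%:R) ^+ 2 / N x) <=
  2 * #|X|%:R * \sum_c b c ^+ 2.
Proof.
move=> IC b0.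
have [C0|] := posnP #|C|.
  rewrite C0 mul0r mulr_ge0 ?mulr_ge0 //.
  by apply: sumr_ge0 => c _; rewrite sqr_ge0.
move=> /card_gt0P[c0 _].
have [t t0 Mt] : exists2 t, 0 <= t & forall c c', c != c' -> cross_moment c c' = t.
  case: (pickP (fun p : C * C => p.1 != p.2)) => [[e e'] /= ee'|E].
    exists (cross_moment e e'); first exact: cross_moment_ge0.
    by move=> c c' cc'; apply: cross_moment_offdiag.
  by exists 0 => // c c' cc'; have := E (c, c'); rewrite /= cc'.
set s := cross_moment c0 c0.
have Ds : D * s <= 2 * #|X|%:R.
  apply: le_trans (sum_pairs_sq_le IC).
  under [leRHS]eq_bigr => x _ do rewrite mulr_suml.
  rewrite exchange_big /= mulr_natl -sumr_const.
  apply: ler_sum => c _; rewrite /s (cross_moment_diag c0 c).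
  by apply: ler_sum => x _; rewrite expr2 natrM.
have -> : \sum_x (\sum_c b c * (pairs_at x c)%:R) ^+ 2 / N x =
    \sum_c \sum_c' b c * b c' * cross_moment c c'.
  rewrite /cross_moment.
  under [RHS]eq_bigr => c _.
    under eq_bigr => c' _ do rewrite mulr_sumr.
    rewrite exchange_big /=; over.
  rewrite exchange_big /=; apply: eq_bigr => x _.
  rewrite expr2 mulr_suml mulr_suml; apply: eq_bigr => c _.
  rewrite mulr_sumr mulr_suml; apply: eq_bigr => c' _.
  by rewrite natrM; ring.
have -> : \sum_c \sum_c' b c * b c' * cross_moment c c' =
    (s - t) * \sum_c b c ^+ 2.
  rewrite mulr_sumr; apply: eq_bigr => c _.
  rewrite (bigD1 c) //= (eq_bigr (fun c' => b c * t * b c')); last first.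
    by move=> c' cc'; rewrite Mt 1?eq_sym //; ring.
  have -> : cross_moment c c = s by exact: cross_moment_diag.
  rewrite -mulr_sumr.
  move: b0; rewrite (bigD1 c) //= => /eqP; rewrite addrC addr_eq0 => /eqP ->.
  by ring.
rewrite mulrA ler_wpM2r //; first by apply: sumr_ge0 => c _; rewrite sqr_ge0.
by apply: le_trans Ds; rewrite ler_wpM2l // lerBlDr lerDl.
Qed.

Definition mix x y : X := [ffun l => if l \in I then y l else x l].

Lemma hits_mix x y c : hits (mix x y) c = hits y c.
Proof.
by apply: eq_card => l; rewrite !inE ffunE; case: (l \in I).
Qed.

(** The labels in [I] can be drawn afresh independently of the others:
    exchanging the two restrictions to [I] is an involution. *)
Lemma sum_mix (F : X -> R) :
  #|X|%:R * (\sum_x F x) = \sum_x \sum_y F (mix x y).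
Proof.
rewrite [RHS]pair_bigA /=.
pose s (p : X * X) := (mix p.1 p.2, mix p.2 p.1).
have ss : involutive s.
  move=> [x y]; rewrite /s /=; congr (_, _); apply/ffunP => l; rewrite !ffunE;
  by case: (l \in I).
rewrite [RHS](reindex_inj (inv_inj ss)) /=.
transitivity (\sum_(p : X * X) F p.1).
  rewrite -(pair_bigA _ (fun x (_ : X) => F x)) /= mulr_sumr.
  by apply: eq_bigr => x _; rewrite sumr_const mulr_natl.
apply: eq_bigr => -[x y] _ /=; congr F; apply/ffunP => l; rewrite !ffunE.
by case: (l \in I).
Qed.

Lemma pair_total_mix x y : pair_total (mix x y) = pair_total y.
Proof. by apply: eq_bigr => c _; rewrite /pairs_at hits_mix. Qed.

(** Version of [sum_centered_sq_le] for random weights that depend only on the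
    labels outside [I], such as the errors of an estimator based on the second
    half of the sample. *)
Lemma sum_centered_mix_le (b : X -> C -> R) (L : R) :
  (#|I| <= #|C|)%N -> (0 < #|C|)%N ->
  (forall x y, b (mix x y) = b x) -> (forall x, \sum_c b x c = 0) ->
  (forall x, \sum_c b x c ^+ 2 <= D * L) ->
  \sum_x (\sum_c b x c * (pairs_at x c)%:R) ^+ 2 / N x <= 2 * #|X|%:R * L.
Proof.
move=> IC C0 bmix b0 bL.
have D0 : 0 < D by rewrite ltr0n.
have X0 : 0 < #|X|%:R :> R by rewrite ltr0n card_ffun expn_gt0 C0.
rewrite -(ler_pM2l X0) sum_mix [leRHS]mulr_natl -sumr_const.
apply: ler_sum => x _; rewrite -(ler_pM2l D0).
under eq_bigr => y _.
  rewrite bmix pair_total_mix.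
  under eq_bigr => c _ do rewrite /pairs_at hits_mix.
  over.
apply: le_trans (sum_centered_sq_le IC (b0 x)) _.
by rewrite mulrCA ler_wpM2l // mulr_ge0.
Qed.

End Weighted.
End Cells.

Local Open Scope classical_set_scope.
Local Open Scope ring_scope.

(** * Means of bounded measurable functions *)

Section BoundedMeasurable.
Context d (T : measurableType d) (R : realType).
Implicit Types f g : T -> R.

(** A convenient class on which every mean over a probability space is finite
    and linear. *)
Definition bounded_measurable f :=
  measurable_fun setT f /\ exists M, forall x, `|f x| <= M.

Lemma bounded_measurable_cst r : bounded_measurable (fun=> r).
Proof. by split; [exact: measurable_cst|exists `|r|]. Qed.

Lemma bounded_measurableD f g : bounded_measurable f -> bounded_measurable g ->
  bounded_measurable (fun x => f x + g x).
Proof.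
move=> [mf [M fM]] [mg [M' gM]]; split; first exact: measurable_funD.
exists (M + M') => x; apply: le_trans (ler_normD _ _) _.
exact: lerD.
Qed.

Lemma bounded_measurableM f g : bounded_measurable f -> bounded_measurable g ->
  bounded_measurable (fun x => f x * g x).
Proof.
move=> [mf [M fM]] [mg [M' gM]]; split; first exact: measurable_funM.
by exists (M * M') => x; rewrite normrM ler_pM.
Qed.

Lemma bounded_measurableX f k : bounded_measurable f ->
  bounded_measurable (fun x => f x ^+ k).
Proof.
move=> [mf [M fM]]; split; first exact: measurable_funX.
by exists (M ^+ k) => x; rewrite normrX lerXn2r // nnegrE (le_trans _ (fM x)).
Qed.

Lemma bounded_measurableN f : bounded_measurable f ->
  bounded_measurable (fun x => - f x).
Proof.
move=> [mf [M fM]]; split; first exact: measurableT_comp.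
by exists M => x; rewrite normrN.
Qed.

Lemma bounded_measurableB f g : bounded_measurable f -> bounded_measurable g ->
  bounded_measurable (fun x => f x - g x).
Proof.
by move=> bf bg; apply: bounded_measurableD => //; apply: bounded_measurableN.
Qed.

Lemma bounded_measurable_sum I (s : seq I) (h : I -> T -> R) :
  (forall i, bounded_measurable (h i)) ->
  bounded_measurable (fun x => \sum_(i <- s) h i x).
Proof.
move=> bh; elim: s => [|i s IH].
  by under eq_fun do rewrite big_nil; exact: bounded_measurable_cst.
by under eq_fun do rewrite big_cons; exact: bounded_measurableD.
Qed.

Variable P : probability T R.

Lemma bounded_measurable_integrable f :
  bounded_measurable f -> P.-integrable setT (EFin \o f).
Proof.
move=> [mf [M fM]]; apply: measurable_bounded_integrable => //.
  by rewrite -ge0_fin_numE //; exact: fin_num_measure.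
exists M; split; first by rewrite num_real.
by move=> x Mx y _; apply: le_trans (fM y) (ltW Mx).
Qed.

Local Notation E f := (\int[P]_x f x).

Lemma meanD f g : bounded_measurable f -> bounded_measurable g ->
  E (fun x => f x + g x) = E f + E g.
Proof. by move=> bf bg; rewrite RintegralD//; exact: bounded_measurable_integrable. Qed.

Lemma meanZl r f : bounded_measurable f -> E (fun x => r * f x) = r * E f.
Proof. by move=> bf; rewrite RintegralZl//; exact: bounded_measurable_integrable. Qed.

Lemma mean_cst r : E (fun=> r) = r.
Proof.
rewrite Rintegral_cst// -[RHS]mulr1; congr (_ * _).
by rewrite -[RHS]/(fine 1); congr fine; exact: probability_setT.
Qed.

Lemma mean_le f g : bounded_measurable f -> bounded_measurable g ->
  (forall x, f x <= g x) -> E f <= E g.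
Proof. by move=> bf bg fg; apply: le_Rintegral => //; exact: bounded_measurable_integrable. Qed.

Lemma mean_sum I (s : seq I) (h : I -> T -> R) :
  (forall i, bounded_measurable (h i)) ->
  E (fun x => \sum_(i <- s) h i x) = \sum_(i <- s) E (h i).
Proof.
move=> bh; elim: s => [|i s IH].
  rewrite big_nil -[RHS](mean_cst 0).
  by congr Rintegral; apply/funext => x; rewrite big_nil.
rewrite big_cons -IH -meanD //; last exact: bounded_measurable_sum.
by congr Rintegral; apply/funext => x; rewrite big_cons.
Qed.

(** Markov's inequality, where the lower bound on the event is only required
    almost surely. *)
Lemma prob_le_mean (A : set T) f : measurable A -> bounded_measurable f ->
  (forall x, 0 <= f x) -> {ae P, forall x, A x -> 1 <= f x} ->
  (P A <= (E f)%:E)%E.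
Proof.
move=> mA bf f0 [N0 [mN0 PN0 fA]].
have mAN : measurable (A `\` N0) by exact: measurableD.
have bA : bounded_measurable (\1_(A `\` N0) : T -> R).
  split; first exact: measurable_indic.
  by exists 1 => x; rewrite indicE; case: (x \in _); rewrite ?normr1 ?normr0.
have PA : (P A <= P (A `\` N0))%E.
  have AU : A `<=` (A `\` N0) `|` N0 by move=> x Ax; case: (pselect (N0 x)); [right|left].
  have mAU : measurable ((A `\` N0) `|` N0) by exact: measurableU.
  apply: (le_trans (le_measure P (mem_set mA) (mem_set mAU) AU)).
  apply: (le_trans (measureU2 P mAN mN0)).
  by rewrite [X in (_ + X)%E]PN0 adde0.
apply: (le_trans PA).
rewrite -(fineK (fin_num_measure P _ mAN)) lee_fin.
have -> : fine (P (A `\` N0)) = E (\1_(A `\` N0)).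
  by rewrite /Rintegral integral_indic// setIT.
apply: mean_le => // x; rewrite indicE; case: (boolP (x \in _)) => [/set_mem[Ax nN]|_] //=.
by apply: contrapT => h; apply/nN/fA => /(_ Ax).
Qed.

Lemma prob_finite_union (J : finType) (F : J -> set T) :
  (forall i, measurable (F i)) -> trivIset setT F ->
  P (\bigcup_(i in [set: J]) F i) = (\sum_i P (F i))%E.
Proof.
move=> mF tF; rewrite measure_fin_bigcup //; last exact: finite_finset.
have <- : [set` index_enum J] = [set: J].
  by apply/seteqP; split => // i _; rewrite /= mem_index_enum.
by rewrite -fsbig_seq // index_enum_uniq.
Qed.

End BoundedMeasurable.

Lemma bounded_measurable_comp d (T : measurableType d) d'
    (T' : measurableType d') (R : realType) (h : T' -> T) (f : T -> R) :
  measurable_fun setT h -> bounded_measurable f ->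
  bounded_measurable (fun x => f (h x)).
Proof.
move=> mh [mf [M fM]]; split; first exact: measurableT_comp.
by exists M.
Qed.

(** * Product rule for independent variables *)

Section IndependentPair.
Local Open Scope ereal_scope.
Context d (Omega : measurableType d) (R : realType) (P : probability Omega R).
Context d1 (T1 : measurableType d1) d2 (T2 : measurableType d2).
Variables (V : {RV P >-> T1}) (Z : {RV P >-> T2}).
Hypothesis indVZ : forall A B, measurable A -> measurable B ->
  P (V @^-1` A `&` Z @^-1` B) = P (V @^-1` A) * P (Z @^-1` B).

Let VZ w : T1 * T2 := (V w, Z w).

Let mVZ : measurable_fun setT VZ.
Proof. by apply: measurable_fun_pair; exact: measurable_funP. Qed.

HB.instance Definition _ := isMeasurableFun.Build _ _ _ _ VZ mVZ.

(** The joint law is the product of the laws, so Fubini's theorem applies. *)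
Lemma mean_mul_indep (f : T1 -> R) (g : T2 -> R) :
  bounded_measurable f -> bounded_measurable g ->
  (\int[P]_w (f (V w) * g (Z w)) =
   \int[P]_w f (V w) * \int[P]_w g (Z w))%R.
Proof.
move=> bf bg.
have mV : measurable_fun setT V by exact: measurable_funP.
have mZ : measurable_fun setT Z by exact: measurable_funP.
have bfV := bounded_measurable_comp mV bf.
have bgZ := bounded_measurable_comp mZ bg.
have bfg : bounded_measurable (fun p : T1 * T2 => f p.1 * g p.2)%R.
  apply: bounded_measurableM.
  - exact: (bounded_measurable_comp measurable_fst).
  - exact: (bounded_measurable_comp measurable_snd).
have lawE : forall X, measurable X ->
    (distribution P V \x distribution P Z) X = distribution P VZ X.
  apply: product_measure_unique => A B mA mB.
  by rewrite /distribution /pushforward /= -indVZ.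
rewrite /Rintegral.
have -> : \int[P]_w (f (V w) * g (Z w))%:E =
    \int[distribution P VZ]_p (f p.1 * g p.2)%:E.
  rewrite integral_distribution //; first by apply/measurable_EFinP; case: bfg.
  apply: bounded_measurable_integrable.
  exact: (bounded_measurable_comp mVZ bfg).
have -> : \int[distribution P VZ]_p (f p.1 * g p.2)%:E =
    \int[distribution P V \x distribution P Z]_p (f p.1 * g p.2)%:E.
  by apply: eq_measure_integral => X mX _; rewrite /= lawE.
rewrite -integral12_prod_meas1; last first.
  apply/integrableP; split; first by apply/measurable_EFinP; case: bfg.
  have [] := integrableP _ _ _ (bounded_measurable_integrable (distribution P VZ) bfg).
  move=> _; rewrite (eq_measure_integral (distribution P V \x distribution P Z)) //.
  by move=> X mX _; rewrite /= lawE.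
have bgfin : \int[P]_w (g (Z w))%:E \is a fin_num.
  apply: integrable_fin_num => //; exact: bounded_measurable_integrable.
have bffin : \int[P]_w (f (V w))%:E \is a fin_num.
  apply: integrable_fin_num => //; exact: bounded_measurable_integrable.
rewrite /fubini_F /=.
under eq_integral => x _.
  rewrite (eq_integral (fun y => (f x)%:E * (g y)%:E)); last first.
    by move=> y _; rewrite EFinM.
  rewrite integralZl //; last exact: bounded_measurable_integrable.
  rewrite integral_distribution /=; last 2 first.
  - by apply/measurable_EFinP; case: bg.
  - exact: bounded_measurable_integrable.
  over.
rewrite -(fineK bgfin) integralZr //; last exact: bounded_measurable_integrable.
rewrite integral_distribution /=; last 2 first.
- by apply/measurable_EFinP; case: bf.
- exact: bounded_measurable_integrable.
by rewrite -(fineK bffin) -EFinM.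
Qed.

End IndependentPair.

Section Coordinates.
Local Open Scope ereal_scope.
Context d (Omega : measurableType d) (R : realType) (P : probability Omega R).
Context (n : nat) (W : 'I_n -> {RV P >-> R}).
Hypothesis indW : mutually_independent W.

Definition joint w : n.-tuple R := [tuple W i w | i < n].

Lemma measurable_joint : measurable_fun setT joint.
Proof.
apply/measurable_fun_tnthP => i.
have -> : (@tnth n R ^~ i) \o joint = W i.
  by apply/funext => w /=; rewrite tnth_mktuple.
exact: measurable_funP.
Qed.

(** Functions of the coordinates other than [l] are encoded as functions of
    the whole tuple that are invariant under [erase l]. *)
Definition erase l (t : n.-tuple R) : n.-tuple R :=
  [tuple if i == l then 0%R else tnth t i | i < n].

Lemma tnth_erase l t i : tnth (erase l t) i = if i == l then 0%R else tnth t i.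
Proof. by rewrite tnth_mktuple. Qed.

Lemma measurable_erase l : measurable_fun setT (erase l).
Proof.
apply/measurable_fun_tnthP => i.
have -> : (@tnth n R ^~ i) \o erase l =
    (fun t => if i == l then 0%R else tnth t i).
  by apply/funext => t /=; rewrite tnth_erase.
by case: (i == l); [exact: measurable_cst|exact: measurable_tnth].
Qed.

Definition box (B : 'I_n -> set R) : set (n.-tuple R) :=
  [set t | forall i, B i (tnth t i)].

(** A generating family of the product sigma-algebra that is stable under
    intersection. *)
Definition boxes : set (set (n.-tuple R)) :=
  [set box B | B in [set B | forall i, measurable (B i)]].

Lemma measurable_boxes : measurable = <<s boxes >>.
Proof.
apply/seteqP; split.
  apply: smallest_sub; first exact: smallest_sigma_algebra.
  rewrite -bigcup_seq => X /= [i _ [A mA <-]].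
  apply: sub_sigma_algebra; exists (fun j => if j == i then A else setT).
    by move=> j /=; case: (j == i).
  apply/seteqP; split => t /=; last first.
    by move=> [_ At] j; case: eqP => // ->.
  by move=> /(_ i); rewrite eqxx.
apply: smallest_sub; first exact: sigma_algebra_measurable.
move=> _ [B mB <-].
have -> : box B = \big[setI/setT]_(i < n) (@tnth n R ^~ i) @^-1` B i.
  rewrite -bigcap_seq; apply/seteqP; split => t /= Bt.
    by move=> i _; exact: Bt.
  by move=> i; apply: Bt => /=; rewrite mem_index_enum.
apply: bigsetI_measurable => i _.
by rewrite -[X in measurable X]setTI; exact: measurable_tnth.
Qed.

Section OneCoordinate.
Variable l : 'I_n.

Let rest w := erase l (joint w).

Let measurable_rest : measurable_fun setT rest.
Proof. exact: (measurableT_comp (measurable_erase l) measurable_joint). Qed.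

HB.instance Definition _ := isMeasurableFun.Build _ _ _ _ rest measurable_rest.

Let rest_rv : {RV P >-> n.-tuple R} := rest.

Lemma indep_coordinate_box A B : measurable A -> (forall i, measurable (B i)) ->
  P (W l @^-1` A `&` rest @^-1` box B) = P (W l @^-1` A) * P (rest @^-1` box B).
Proof.
move=> mA mB.
have [B0|B0] := pselect (B l 0%R); last first.
  have -> : rest @^-1` box B = set0.
    by apply/seteqP; split => // w /= /(_ l); rewrite tnth_erase eqxx.
  by rewrite setI0 measure0 mule0.
have restE w : (rest @^-1` box B) w <-> (forall i, i != l -> B i (W i w)).
  split => /= H i; last first.
    rewrite tnth_erase; case: eqP => [->//|/eqP il].
    by rewrite tnth_mktuple; exact: H.
  by move=> il; have := H i; rewrite tnth_erase (negPf il) tnth_mktuple.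
have -> : rest @^-1` box B =
    \bigcap_(i in [set` [set~ l]%SET]) (W i @^-1` B i).
  apply/seteqP; split => w.
    by move=> /restE H i /=; rewrite !inE; exact: H.
  by move=> H; apply/restE => i il; apply: H; rewrite /= !inE.
pose B' i := if i == l then A else B i.
have mB' i : measurable (B' i) by rewrite /B'; case: (i == l).
have -> : W l @^-1` A `&` \bigcap_(i in [set` [set~ l]%SET]) (W i @^-1` B i) =
    \bigcap_(i in [set` [set: 'I_n]%SET]) (W i @^-1` B' i).
  apply/seteqP; split => w /=.
    move=> [Aw H] i _ /=; rewrite /B'; case: eqP => [->//|/eqP il].
    by apply: H => /=; rewrite !inE.
  move=> H; split; first by have := H l; rewrite /B' /= eqxx inE; exact.
  by move=> i /=; rewrite !inE => il; have := H i; rewrite /B' /= (negPf il) inE; exact.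
rewrite !indW // (bigD1 l) ?inE //= /B' eqxx; congr (_ * _).
apply: eq_big => [i|i]; rewrite !inE //= => il; by rewrite (negPf il).
Qed.

(** Mutual independence is a product rule for boxes; for a fixed event on the
    coordinate [l], two finite measures that agree on boxes agree on all
    measurable sets. *)
Lemma indep_coordinate A X : measurable A -> measurable X ->
  P (W l @^-1` A `&` rest @^-1` X) = P (W l @^-1` A) * P (rest @^-1` X).
Proof.
move=> mA mX.
have mWA : measurable (W l @^-1` A).
  by rewrite -[X in measurable X]setTI; exact: measurable_funP.
have r0 : (0 <= fine (P (W l @^-1` A)))%R by rewrite fine_ge0.
pose r := NngNum r0.
(* The law of the other coordinates restricted to the event [W l \in A],
   against the multiple of the unrestricted law by the probability of that
   event. *)
pose m1 := measure_function_pushforward__canonical__measure_function_Measure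
  (mrestr P mWA) measurable_rest.
pose m2 : {measure set (n.-tuple R) -> \bar R} := mscale r (distribution P rest_rv).
have m1E Y : m1 Y = P (W l @^-1` A `&` rest @^-1` Y).
  by rewrite setIC.
have mrest Y : measurable Y -> measurable (rest @^-1` Y).
  by move=> mY; rewrite -[X in measurable X]setTI; exact: measurable_rest.
have rE : (fine (P (W l @^-1` A)))%:E = P (W l @^-1` A) by rewrite fineK // fin_num_measure.
have m2E Y : m2 Y = P (W l @^-1` A) * P (rest @^-1` Y) by rewrite -rE.
rewrite -m1E -m2E; apply: (measure_unique boxes (fun=> setT)) => //.
- exact: measurable_boxes.
- move=> _ _ [B mB <-] [B' mB' <-]; exists (fun i => B i `&` B' i).
    by move=> i /=; apply: measurableI; [exact: mB|exact: mB'].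
  apply/seteqP; split => t /=.
    by move=> H; split => i; have [] := H i.
  by move=> [H H'] i; split; [exact: H|exact: H'].
- by move=> _; exists (fun=> setT) => //; apply/seteqP; split.
- by rewrite bigcup_const.
- move=> _ [B mB <-].  by rewrite m1E m2E indep_coordinate_box.
- move=> _; rewrite m1E preimage_setT setIT.
  by rewrite -ge0_fin_numE // fin_num_measure.
Qed.

Lemma mean_mul_coordinate (u : R -> R) (F : n.-tuple R -> R) :
  bounded_measurable u -> bounded_measurable F ->
  (forall t, F (erase l t) = F t) ->
  (\int[P]_w (u (W l w) * F (joint w)) =
   \int[P]_w u (W l w) * \int[P]_w F (joint w))%R.
Proof.
move=> bu bF FE.
have := @mean_mul_indep _ _ _ P _ _ _ _ (W l) rest_rv indep_coordinate u F bu bF.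
have -> : (fun w => F (rest_rv w)) = (fun w => F (joint w)).
  by apply/funext => w; exact: FE.
have -> : (fun w => u (W l w) * F (rest_rv w))%R =
          (fun w => u (W l w) * F (joint w))%R.
  by apply/funext => w; congr (_ * _)%R; exact: FE.
by [].
Qed.

End OneCoordinate.
End Coordinates.

(** * Second moment of a sum of noise pairs *)

Section PairNoise.
Context d (Omega : measurableType d) (R : realType) (P : probability Omega R).
Context (n : nat) (W : 'I_n -> {RV P >-> R}).
Hypothesis indW : mutually_independent W.
Variables (u : R -> R) (v : R).
Hypothesis bu : bounded_measurable u.
Hypothesis u1 : forall i, \int[P]_w u (W i w) = 0.
Hypothesis u2 : forall i, \int[P]_w (u (W i w) ^+ 2) = v.
Implicit Types (F G : n.-tuple R -> R) (ps : seq ('I_n * 'I_n)).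

Definition noise_mean F : R := \int[P]_w F (joint W w).
Local Notation E := noise_mean.

Let e i (t : n.-tuple R) := u (tnth t i).

Lemma bounded_measurable_coord i : bounded_measurable (e i).
Proof. exact: (bounded_measurable_comp (measurable_tnth i)). Qed.

Lemma coord_erase i l t : i != l -> e i (erase l t) = e i t.
Proof. by move=> il; rewrite /e tnth_erase (negPf il). Qed.

Lemma bounded_measurable_joint F : bounded_measurable F ->
  bounded_measurable (fun w => F (joint W w)).
Proof. exact: (bounded_measurable_comp (measurable_joint W)). Qed.

Lemma noise_meanD F G : bounded_measurable F -> bounded_measurable G ->
  E (fun t => F t + G t) = E F + E G.
Proof.
by move=> bF bG; rewrite /noise_mean meanD //; exact: bounded_measurable_joint.
Qed.

Lemma mean_coord_mul l F : bounded_measurable F ->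
  (forall t, F (erase l t) = F t) -> E (fun t => e l t * F t) = 0.
Proof.
move=> bF FE; rewrite -[RHS](mul0r (E F)) -(u1 l) /noise_mean.
rewrite -(mean_mul_coordinate indW bu bF FE).
by congr Rintegral; apply/funext => w; rewrite /= /e tnth_mktuple.
Qed.

Lemma mean_coord_sq_mul l F : bounded_measurable F ->
  (forall t, F (erase l t) = F t) -> E (fun t => e l t ^+ 2 * F t) = v * E F.
Proof.
move=> bF FE; rewrite -(u2 l).
rewrite -(mean_mul_coordinate indW (bounded_measurableX 2 bu) bF FE).
by congr Rintegral; apply/funext => w; rewrite /= /e tnth_mktuple.
Qed.

(** The cross term vanishes because the coordinate [l] is centered and
    independent of [F * G]. *)
Lemma mean_affine_sq l F G : bounded_measurable F -> bounded_measurable G ->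
  (forall t, F (erase l t) = F t) -> (forall t, G (erase l t) = G t) ->
  E (fun t => (F t + G t * e l t) ^+ 2) =
  E (fun t => F t ^+ 2) + v * E (fun t => G t ^+ 2).
Proof.
move=> bF bG FE GE.
have be := bounded_measurable_coord l.
have -> : (fun t => (F t + G t * e l t) ^+ 2) =
    (fun t => F t ^+ 2 + (e l t * (2 * (F t * G t)) + e l t ^+ 2 * G t ^+ 2)).
  by apply/funext => t; ring.
have bFG : bounded_measurable (fun t => 2 * (F t * G t)).
  apply: bounded_measurableM; first exact: bounded_measurable_cst.
  exact: bounded_measurableM.
have bF2 := bounded_measurableX 2 bF.
have bG2 := bounded_measurableX 2 bG.
have be2 := bounded_measurableX 2 be.
have b1 := bounded_measurableM be bFG.
have b2 := bounded_measurableM be2 bG2.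
rewrite (noise_meanD bF2 (bounded_measurableD b1 b2)) (noise_meanD b1 b2).
rewrite mean_coord_mul //; last by move=> t; rewrite FE GE.
by rewrite add0r mean_coord_sq_mul // => t; rewrite GE.
Qed.

(** As a function of the coordinate [l] the expression is affine, and the two
    coefficients are affine functions of the coordinate [s]; hence three
    applications of [mean_affine_sq]. *)
Lemma mean_one_pair_sq l s F G : l != s ->
  bounded_measurable F -> bounded_measurable G ->
  (forall t, F (erase l t) = F t) -> (forall t, F (erase s t) = F t) ->
  (forall t, G (erase l t) = G t) -> (forall t, G (erase s t) = G t) ->
  E (fun t => (F t + (G t * (e l t + e s t) + e l t * e s t)) ^+ 2) =
  E (fun t => F t ^+ 2) + (2 * v * E (fun t => G t ^+ 2) + v ^+ 2).
Proof.
move=> ls bF bG Fl Fs Gl Gs.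
have be := bounded_measurable_coord s.
transitivity (E (fun t => (F t + G t * e s t + (G t + 1 * e s t) * e l t) ^+ 2)).
  by congr noise_mean; apply/funext => t; ring.
have b1 := bounded_measurable_cst (n.-tuple R) (1 : R).
rewrite mean_affine_sq; last 4 first.
- by apply: bounded_measurableD => //; exact: bounded_measurableM.
- by apply: bounded_measurableD => //; exact: bounded_measurableM.
- by move=> t; rewrite Fl Gl coord_erase // eq_sym.
- by move=> t; rewrite Gl coord_erase // eq_sym.
rewrite mean_affine_sq // mean_affine_sq //.
have -> : E (fun=> 1 ^+ 2) = 1 by rewrite /noise_mean expr1n mean_cst.
by ring.
Qed.

Definition pair_indices ps : seq 'I_n := flatten [seq [:: p.1; p.2] | p <- ps].

(** Pythagoras for pair products over disjoint indices, which are orthogonal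
    to one another and to functions of the other coordinates. The partial sum
    over the remaining pairs is free of the two coordinates of a new pair. *)
Lemma mean_pairs_sq ps F (G : 'I_n * 'I_n -> n.-tuple R -> R) :
  uniq (pair_indices ps) ->
  bounded_measurable F -> (forall p, bounded_measurable (G p)) ->
  (forall i t, i \in pair_indices ps -> F (erase i t) = F t) ->
  (forall p i t, i \in pair_indices ps -> G p (erase i t) = G p t) ->
  E (fun t => (F t + \sum_(p <- ps)
       (G p t * (e p.1 t + e p.2 t) + e p.1 t * e p.2 t)) ^+ 2) =
  E (fun t => F t ^+ 2) +
    \sum_(p <- ps) (2 * v * E (fun t => G p t ^+ 2) + v ^+ 2).
Proof.
move=> + bF bG; elim: ps => [|[l s] ps IH] /= ups FE GE.
  rewrite big_nil addr0; congr noise_mean; apply/funext => t.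
  by rewrite big_nil addr0.
move: ups; rewrite inE negb_or => /and3P[/andP[ls lps] sps ups].
pose F' t := F t + \sum_(p <- ps)
  (G p t * (e p.1 t + e p.2 t) + e p.1 t * e p.2 t).
have F'E i t : i \in [:: l, s & pair_indices ps] -> i \notin pair_indices ps ->
    F' (erase i t) = F' t.
  move=> iin inot; rewrite /F' FE //; congr (_ + _).
  apply: eq_big_seq => -[l' s'] pin /=; rewrite GE //.
  have /andP[l'i s'i] : (l' != i) && (s' != i).
    apply/andP; split; apply: contraNneq inot => <-; apply/flatten_mapP;
    by exists (l', s') => //; rewrite !inE eqxx ?orbT.
  by rewrite !coord_erase.
have bF' : bounded_measurable F'.
  apply: bounded_measurableD => //; apply: bounded_measurable_sum => p.
  have be i := bounded_measurable_coord i.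
  apply: bounded_measurableD; apply: bounded_measurableM => //.
  exact: bounded_measurableD.
rewrite big_cons /=.
transitivity (E (fun t => (F' t + (G (l, s) t * (e l t + e s t) + e l t * e s t)) ^+ 2)).
  by congr noise_mean; apply/funext => t; rewrite big_cons /F' /=; ring.
rewrite mean_one_pair_sq //; last first.
- by move=> t; apply: GE; rewrite !inE eqxx orbT.
- by move=> t; apply: GE; rewrite !inE eqxx.
- by move=> t; apply: F'E => //; rewrite !inE eqxx orbT.
- by move=> t; apply: F'E => //; rewrite !inE eqxx.
rewrite /F' IH //; first by ring.
- by move=> i t ips; apply: FE; rewrite !inE ips !orbT.
- by move=> p i t ips; apply: GE; rewrite !inE ips !orbT.
Qed.

End PairNoise.

(** * Pairs formed from a sample observed at matrix units *)

Section MatrixEntries.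
Context (R : realType) (m1 m2 : nat).
Implicit Types A B M : 'M[R]_(m1, m2).
Local Notation cell := ('I_m1 * 'I_m2)%type.

Lemma mx_innerE A B : mx_inner A B = \sum_(c : cell) A c.1 c.2 * B c.1 c.2.
Proof.
rewrite /mx_inner /mxtrace -(pair_bigA _ (fun i j => A i j * B i j)) /=.
rewrite exchange_big /=; apply: eq_bigr => j _.
by rewrite mxE; apply: eq_bigr => i _; rewrite mxE.
Qed.

Lemma mx_innerC A B : mx_inner A B = mx_inner B A.
Proof. by rewrite !mx_innerE; apply: eq_bigr => c _; rewrite mulrC. Qed.

Lemma mx_inner_delta A (c : cell) : mx_inner A (delta_mx c.1 c.2) = A c.1 c.2.
Proof.
rewrite mx_innerE (bigD1 c) //= big1 ?addr0.
  by rewrite mxE !eqxx mulr1.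
move=> c' c'c; rewrite mxE.
have -> : (c'.1 == c.1) && (c'.2 == c.2) = (c' == c) by case: c c' {c'c} => ? ? [? ?].
by rewrite (negPf c'c) mulr0.
Qed.

Lemma delta_mx_cell_inj (c c' : cell) :
  (delta_mx c.1 c.2 == delta_mx c'.1 c'.2 :> 'M[R]_(m1, m2)) = (c == c').
Proof.
apply/eqP/eqP => [e|->//].
have := congr1 (fun A : 'M[R]_(m1, m2) => A c'.1 c'.2) e; rewrite !mxE !eqxx /=.
case: (eqVneq c'.1 c.1) => [e1|_] /=; last by move/eqP; rewrite eq_sym oner_eq0.
case: (eqVneq c'.2 c.2) => [e2|_] /=; last by move/eqP; rewrite eq_sym oner_eq0.
by move=> _; case: c c' e1 e2 {e} => ? ? [? ?] /= -> ->.
Qed.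

Lemma frobenius_sqE A : frobenius A ^+ 2 = \sum_(c : cell) A c.1 c.2 ^+ 2.
Proof.
have E : mx_inner A A = \sum_(c : cell) A c.1 c.2 ^+ 2.
  by rewrite mx_innerE; apply: eq_bigr.
rewrite /frobenius sqr_sqrtr E //; by apply: sumr_ge0 => c _; rewrite sqr_ge0.
Qed.

Lemma frobenius_ge0 A : 0 <= frobenius A.
Proof. exact: sqrtr_ge0. Qed.

Lemma mx_norm_leP a A : 0 <= a -> `|A| <= a <-> forall i j, `|A i j| <= a.
Proof.
move=> a0; rewrite /Num.norm /= mx_normrE; split.
  move=> H i j; apply: le_trans H.
  by rewrite (le_bigmax _ (fun ij : 'I_m1 * 'I_m2 => `|A ij.1 ij.2|) (i, j)).
by move=> H; apply: bigmax_le => // -[i j] _; exact: H.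
Qed.

End MatrixEntries.

Section ConsecutivePairs.
Variable T : eqType.
Implicit Types o : seq T.

Lemma size_consecutive_pairs o : size (consecutive_pairs o) = (size o)./2.
Proof.
have [k] := ubnP (size o); elim: k o => // k IH [|x [|y o]] //= ok.
by rewrite IH //; move: ok; rewrite !ltnS => /ltnW.
Qed.

Lemma consecutive_pairs_mem o p :
  p \in consecutive_pairs o -> (p.1 \in o) && (p.2 \in o).
Proof.
have [k] := ubnP (size o); elim: k o => // k IH [|x [|y o]] //= ok.
rewrite inE => /orP[/eqP->|/IH] /=; first by rewrite !inE !eqxx orbT.
move=> /(_ _)/andP[|h1 h2]; first by move: ok; rewrite !ltnS => /ltnW.
by rewrite !inE h1 h2 !orbT.
Qed.

Lemma count_consecutive_pairs (a : pred T) o :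
  (count a (flatten [seq [:: p.1; p.2] | p <- consecutive_pairs o]) <=
   count a o)%N.
Proof.
have [k] := ubnP (size o); elim: k o => // k IH [|x [|y o]] //= ok.
by rewrite !leq_add2l IH //; move: ok; rewrite !ltnS => /ltnW.
Qed.

End ConsecutivePairs.

Lemma half_le_self (k : nat) : (k./2 <= k)%N.
Proof. by rewrite -{2}(odd_double_half k); lia. Qed.

Section GridSample.
Context (R : realType) (m1 m2 n : nat).
Local Notation cell := ('I_m1 * 'I_m2)%type.
Local Notation mx := 'M[R]_(m1, m2).
Implicit Types (s : n.-tuple (mx * R)) (x : {ffun 'I_n -> cell}).

Definition first_half : {set 'I_n} := [set l : 'I_n | (l < n./2)%N].

Definition has_design x s := forall l, (tnth s l).1 = delta_mx (x l).1 (x l).2.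

Definition cell_pairs x : seq ('I_n * 'I_n) :=
  flatten [seq consecutive_pairs [seq l <- enum 'I_n | (l \in first_half) && (x l == c)]
          | c <- enum {: cell}].

Lemma card_first_half : #|first_half| = n./2.
Proof.
have H := half_le_self n.
rewrite -sum1_card (eq_bigl (fun l : 'I_n => l < n./2)%N) => [|l]; last by rewrite inE.
by rewrite -(big_ord_widen n (fun=> 1%N)) // sum1_card card_ord.
Qed.

Lemma sample_pairs_design x s : has_design x s -> sample_pairs s = cell_pairs x.
Proof.
move=> xs; congr flatten; apply: eq_map => c; congr consecutive_pairs.
by apply: eq_filter => l; rewrite xs delta_mx_cell_inj inE.
Qed.

Lemma size_cell_obs x c :
  size [seq l <- enum 'I_n | (l \in first_half) && (x l == c)] =
  hits first_half x c.
Proof.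
rewrite -(card_uniqP (filter_uniq _ (enum_uniq 'I_n))).
by apply: eq_card => l; rewrite mem_filter mem_enum !inE andbT.
Qed.

Lemma size_cell_pairs x : size (cell_pairs x) = pair_total first_half x.
Proof.
rewrite size_flatten /shape -map_comp sumnE big_map big_enum /=.
by apply: eq_bigr => c _; rewrite size_consecutive_pairs size_cell_obs.
Qed.

Lemma cell_pairs_mem x p : p \in cell_pairs x ->
  [/\ p.1 \in first_half, p.2 \in first_half & x p.2 = x p.1].
Proof.
move=> /flatten_mapP[c _ /consecutive_pairs_mem].
by rewrite !mem_filter => /andP[/andP[/andP[-> /eqP->] _] /andP[/andP[-> /eqP->] _]].
Qed.

(** Observations of different cells are distinct, and within a cell
    consecutive pairs do not overlap. *)
Lemma uniq_cell_pairs x : uniq (pair_indices (cell_pairs x)).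
Proof.
suff H l : (count_mem l (pair_indices (cell_pairs x)) <= 1)%N.
  apply: count_mem_uniq => l; have := H l; rewrite -has_pred1 has_count.
  by case: count => [|[|]].
have -> : pair_indices (cell_pairs x) =
    flatten [seq pair_indices (consecutive_pairs
      [seq l <- enum 'I_n | (l \in first_half) && (x l == c)]) | c <- enum {: cell}].
  rewrite /pair_indices /cell_pairs; elim: (enum {: cell}) => //= c cs IH.
  by rewrite map_cat flatten_cat IH.
rewrite count_flatten -map_comp sumnE big_map big_enum /=.
apply: (@leq_trans (\sum_(c : cell) (x l == c))).
  apply: leq_sum => c _; apply: leq_trans (count_consecutive_pairs _ _) _.
  rewrite count_filter; apply: (@leq_trans (count (fun l' => (l' == l) && (x l == c)) (enum 'I_n))).
    by apply: sub_count => l' /= /and3P[/eqP-> _ ->]; rewrite eqxx.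
  case: (x l == c); last by rewrite (@eq_count _ _ pred0) ?count_pred0 // => l'; rewrite /= andbF.
  rewrite (@eq_count _ _ (pred1 l)); last by move=> l'; rewrite /= andbT.
  by rewrite count_uniq_mem ?enum_uniq // leq_b1.
rewrite (bigD1 (x l)) //= eqxx big1 ?addn0 // => c; by rewrite eq_sym => /negPf->.
Qed.

Lemma sum_cell_pairs x (f : cell -> R) :
  \sum_(p <- cell_pairs x) f (x p.1) =
  \sum_c f c * (pairs_at first_half x c)%:R.
Proof.
rewrite big_flatten /= big_map big_enum /=; apply: eq_bigr => c _.
set o := [seq _ <- _ | _].
rewrite (eq_big_seq (fun=> f c)) => [|p /consecutive_pairs_mem/andP[]].
  rewrite big_const_seq count_predT size_consecutive_pairs size_cell_obs.
  by rewrite iter_addr_0 mulr_natr.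
by rewrite mem_filter => /andP[/andP[_ /eqP->]].
Qed.

End GridSample.

(** * Measurability of the statistics *)

Section SampleMeasurability.
Context (R : realType) (m1 m2 n : nat).
Local Notation cell := ('I_m1 * 'I_m2)%type.
Local Notation mx := 'M[R]_(m1, m2).
Local Notation samples := (n.-tuple (mx * R)%type).
Implicit Types (s : samples).

Lemma measurable_entry (i : 'I_m1) (j : 'I_m2) :
  measurable_fun setT (fun A : mx => A i j).
Proof.
move=> _ Y mY; apply: sub_sigma_algebra; exists (i, j) => //=.
by exists Y.
Qed.

Lemma measurable_mx1 (A : mx) : measurable [set A].
Proof.
have -> : [set A] = \bigcap_(c in [set` enum {: cell}])
    ((fun B : mx => B c.1 c.2) @^-1` [set A c.1 c.2]).
  apply/seteqP; split => B /=; first by move=> ->.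
  move=> H; apply/matrixP => i j; apply: (H (i, j)).
  by rewrite /= mem_enum.
rewrite bigcap_seq; apply: bigsetI_measurable => c _.
by rewrite -[X in measurable X]setTI; exact: measurable_entry.
Qed.

(** All that the pairing uses of a sample: which observation is made at which
    matrix unit. *)
Definition table s : {ffun 'I_n * cell -> bool} :=
  [ffun lc => (tnth s lc.1).1 == delta_mx lc.2.1 lc.2.2].

Lemma measurable_table b : measurable [set s | table s = b].
Proof.
have -> : [set s | table s = b] = \bigcap_(lc in [set` enum {: 'I_n * cell}])
   ((fun s : samples => (tnth s lc.1).1) @^-1`
      (if b lc then [set delta_mx lc.2.1 lc.2.2] else ~` [set delta_mx lc.2.1 lc.2.2])).
  apply/seteqP; split => s /=.
    by move=> <- lc _ /=; rewrite ffunE; case: eqP.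
  move=> H; apply/ffunP => lc; rewrite ffunE; have /= := H lc.
  rewrite mem_enum => /(_ isT); case: (b lc) => [->|]; first by rewrite eqxx.
  by move=> /eqP/negPf.
rewrite bigcap_seq; apply: bigsetI_measurable => lc _.
rewrite -[X in measurable X]setTI.
apply: (measurableT_comp measurable_fst (measurable_tnth lc.1)) => //.
case: (b lc); last apply: measurableC; exact: measurable_mx1.
Qed.

(** The table takes finitely many values, each on a measurable set; this
    reduces measurability to a fixed list of pairs. *)
Lemma measurable_fun_table d (T : measurableType d)
    (h : {ffun 'I_n * cell -> bool} -> samples -> T) :
  (forall b, measurable_fun setT (h b)) ->
  measurable_fun setT (fun s => h (table s) s).
Proof.
move=> mh _ Y mY; rewrite setTI.
have -> : (fun s => h (table s) s) @^-1` Y =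
    \big[setU/set0]_(b <- enum {: {ffun 'I_n * cell -> bool}})
       ([set s | table s = b] `&` h b @^-1` Y).
  rewrite -bigcup_seq; apply/seteqP; split => s /=.
    by move=> Ys; exists (table s); rewrite /= ?mem_enum.
  by move=> [b _ /= [<-]].
apply: bigsetU_measurable => b _; apply: measurableI; first exact: measurable_table.
by rewrite -[X in measurable X]setTI; exact: mh.
Qed.

Definition pairs_of_table (b : {ffun 'I_n * cell -> bool}) :
    seq ('I_n * 'I_n) :=
  flatten [seq consecutive_pairs [seq l : 'I_n <- enum 'I_n | (l < n./2)%N & b (l, jk)]
          | jk <- enum {: cell}].

Lemma sample_pairsE s : sample_pairs s = pairs_of_table (table s).
Proof.
congr flatten; apply: eq_map => c; congr consecutive_pairs.
by apply: eq_filter => l; rewrite ffunE.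
Qed.

Lemma second_half_bound (i : 'I_(n - n./2)) : (n./2 + i < n)%N.
Proof. by have := ltn_ord i; lia. Qed.

Lemma tnth_second_half s (i : 'I_(n - n./2)) :
  tnth (second_half s) i = tnth s (Ordinal (second_half_bound i)).
Proof.
have x0 := tnth s (Ordinal (second_half_bound i)).
by rewrite !(tnth_nth x0) /= nth_drop.
Qed.

Lemma measurable_second_half :
  measurable_fun setT (@second_half (mx * R)%type n).
Proof.
apply/measurable_fun_tnthP => i.
have -> : (@tnth (n - n./2) (mx * R)%type ^~ i) \o @second_half _ n =
    (@tnth n _ ^~ (Ordinal (second_half_bound i))).
  by apply/funext => s /=; rewrite tnth_second_half.
exact: measurable_tnth.
Qed.

Lemma second_half_eq s s' :
  (forall l : 'I_n, (n./2 <= l)%N -> tnth s l = tnth s' l) ->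
  second_half s = second_half s'.
Proof.
move=> H; apply: eq_from_tnth => i; rewrite !tnth_second_half.
by apply: H; rewrite /= leq_addr.
Qed.

Variables (Mhat : half_estimator R m1 m2 n) (a U alpha : R).

Lemma measurable_estimate_entry (i : 'I_m1) (j : 'I_m2) :
  measurable_fun setT (fun s => Mhat (second_half s) i j).
Proof.
apply: (measurableT_comp (measurable_entry i j)).
apply: measurableT_comp; first exact: measurable_funP.
exact: measurable_second_half.
Qed.

Lemma measurable_frobenius_estimate A :
  measurable_fun setT (fun s => frobenius (A - Mhat (second_half s)) ^+ 2).
Proof.
under eq_fun do rewrite frobenius_sqE.
apply: measurable_sum => c; apply: measurable_funX.
under eq_fun do rewrite !mxE.
by apply: measurable_funB; [exact: measurable_cst|exact: measurable_estimate_entry].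
Qed.

Lemma measurable_residual l :
  measurable_fun setT (fun s => residual (Mhat (second_half s)) (tnth s l)).
Proof.
rewrite /residual; apply: measurable_funB.
  exact: (measurableT_comp measurable_snd (measurable_tnth l)).
under eq_fun do rewrite mx_innerE.
apply: measurable_sum => c; apply: measurable_funM.
  exact: measurable_estimate_entry.
apply: (measurableT_comp (measurable_entry c.1 c.2)).
exact: (measurableT_comp measurable_fst (measurable_tnth l)).
Qed.

Lemma measurable_Rhat : measurable_fun setT (Rhat Mhat).
Proof.
pose h b s : R := let N := size (pairs_of_table b) in
  if N == 0%N then 0 else N%:R^-1 * \sum_(p <- pairs_of_table b)
    residual (Mhat (second_half s)) (tnth s p.1) *
    residual (Mhat (second_half s)) (tnth s p.2).
have -> : Rhat Mhat = (fun s => h (table s) s).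
  by apply/funext => s; rewrite /Rhat sample_pairsE.
apply: measurable_fun_table => b; rewrite /h /=.
case: (size _ == 0%N); first exact: measurable_cst.
apply: measurable_funM; first exact: measurable_cst.
apply: measurable_sum => p; apply: measurable_funM; exact: measurable_residual.
Qed.

Lemma measurable_pairs_number (f : nat -> R) :
  measurable_fun setT (fun s => f (size (sample_pairs s))).
Proof.
under eq_fun do rewrite sample_pairsE.
apply: (@measurable_fun_table _ _ (fun b _ => f (size (pairs_of_table b)))) => b.
exact: measurable_cst.
Qed.

Definition radius s : R :=
  Rhat Mhat s + zthreshold a U alpha (size (sample_pairs s)).

Lemma measurable_radius : measurable_fun setT radius.
Proof.
apply: measurable_funD; first exact: measurable_Rhat.
exact: measurable_pairs_number.
Qed.

Lemma measurable_le_fun (f g : samples -> R) :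
  measurable_fun setT f -> measurable_fun setT g ->
  measurable [set s | f s <= g s].
Proof.
move=> mf mg; have /(_ measurableT [set true]) := measurable_fun_ler mf mg.
by rewrite setTI; exact.
Qed.

Lemma measurable_lt_fun (f g : samples -> R) :
  measurable_fun setT f -> measurable_fun setT g ->
  measurable [set s | f s < g s].
Proof.
move=> mf mg; have /(_ measurableT [set true]) := measurable_fun_ltr mf mg.
by rewrite setTI; exact.
Qed.

(** The rank bound [minn m1 m2] holds for every matrix. *)
Lemma confidence_setE s A : confidence_set a U alpha Mhat s A <->
  `|A| <= a /\ frobenius (A - Mhat (second_half s)) ^+ 2 / (m1 * m2)%:R <= radius s.
Proof.
split=> [[[h1 h2] h3]|[h1 h2]] //; split => //; split => //.
by rewrite leq_min rank_leq_row rank_leq_col.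
Qed.

Lemma measurable_coverage (A : mx) :
  measurable [set s | confidence_set a U alpha Mhat s A].
Proof.
have [Aa|Aa] := boolP (`|A| <= a); last first.
  have -> : [set s | confidence_set a U alpha Mhat s A] = set0.
    by apply/seteqP; split => // s /confidence_setE[]; rewrite (negPf Aa).
  exact: measurable0.
have -> : [set s | confidence_set a U alpha Mhat s A] =
   [set s | frobenius (A - Mhat (second_half s)) ^+ 2 / (m1 * m2)%:R <= radius s].
  by apply/seteqP; split => s; rewrite /= confidence_setE; [case|].
apply: measurable_le_fun; last exact: measurable_radius.
apply: measurable_funM; last exact: measurable_cst.
exact: measurable_frobenius_estimate.
Qed.

End SampleMeasurability.

(** * Frobenius diameter and rational matrices *)

Section Diameter.
Context (R : realType) (m1 m2 : nat).
Local Notation cell := ('I_m1 * 'I_m2)%type.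
Local Notation mx := 'M[R]_(m1, m2).
Implicit Types (A B M H : mx) (S : set mx).

Local Notation sq A := (frobenius A ^+ 2).

Lemma frobenius_sq_subC A B : sq (A - B) = sq (B - A).
Proof.
by rewrite !frobenius_sqE; apply: eq_bigr => c _; rewrite !mxE; ring.
Qed.

Lemma frobenius_sq_sub_le A B M : sq (A - B) <= 2 * sq (A - M) + 2 * sq (B - M).
Proof.
rewrite !frobenius_sqE !mulr_sumr -big_split /=; apply: ler_sum => c _.
rewrite !mxE; set x := A _ _; set y := B _ _; set z := M _ _.
rewrite -subr_ge0 (_ : _ - _ = (x + y - 2 * z) ^+ 2) ?sqr_ge0 //.
ring.
Qed.

Lemma frobenius_sq_box_le a A B : 0 <= a -> `|A| <= a -> `|B| <= a ->
  sq (A - B) <= 4 * a ^+ 2 * (m1 * m2)%:R.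
Proof.
move=> a0 /(mx_norm_leP _ a0) Aa /(mx_norm_leP _ a0) Ba.
have -> : 4 * a ^+ 2 * (m1 * m2)%:R = \sum_(c : cell) 4 * a ^+ 2.
  by rewrite sumr_const card_prod !card_ord mulr_natr.
rewrite frobenius_sqE; apply: ler_sum => c _; rewrite !mxE.
have := Aa c.1 c.2; have := Ba c.1 c.2; rewrite !ler_norml.
set x := A _ _; set y := B _ _ => /andP[y1 y2] /andP[x1 x2]; nra.
Qed.

(** A bound [b] on the distances is needed since the supremum of an unbounded
    set of reals is zero by convention; nonnegativity of [t] takes care of the
    empty set. *)
Lemma lt_frobenius_diam S t b : 0 <= t ->
  (forall A B, S A -> S B -> frobenius (A - B) <= b) ->
  t < frobenius_diam S <->
  exists A B, [/\ S A, S B & t < frobenius (A - B)].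
Proof.
move=> t0 Sb; rewrite /frobenius_diam; set V := [set _ | _ in _ & _ in _].
have ubV : has_ubound V by exists b => _ [A SA [B SB <-]]; exact: Sb.
split.
  have [->|/set0P V0] := eqVneq V set0; first by rewrite sup0 ltNge t0.
  by move=> /(sup_gt V0)[_ [A SA [B SB <-]] tAB]; exists A, B.
move=> [A [B [SA SB tAB]]]; apply: lt_le_trans tAB _.
by apply: (ub_le_sup ubV); exists A => //; exists B.
Qed.

Lemma lt_frobenius_diam_sq S t b : 0 <= t ->
  (forall A B, S A -> S B -> frobenius (A - B) <= b) ->
  t < frobenius_diam S ^+ 2 <->
  exists A B, [/\ S A, S B & t < sq (A - B)].
Proof.
move=> t0 Sb.
have lt_sqr x : 0 <= x -> (t < x ^+ 2) = (Num.sqrt t < x).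
  by move=> x0; rewrite -{1}(sqr_sqrtr t0) ltr_sqr ?nnegrE ?sqrtr_ge0.
have d0 : 0 <= frobenius_diam S.
  rewrite leNgt; apply/negP => dlt; have [S0|/set0P[A SA]] := eqVneq S set0.
    move: dlt; rewrite /frobenius_diam.
    have -> : [set frobenius (A - B) | A in S & B in S] = set0.
      by rewrite S0; apply/seteqP; split => // _ [A []].
    by rewrite sup0 ltxx.
  have : frobenius (A - A) <= frobenius_diam S.
    apply: ub_le_sup; last by exists A => //; exists A.
    by exists b => _ [A1 SA1 [B SB <-]]; exact: Sb.
  by move/le_lt_trans/(_ dlt); rewrite ltNge frobenius_ge0.
rewrite lt_sqr // (lt_frobenius_diam (sqrtr_ge0 t) Sb).
by split=> -[A [B [SA SB tAB]]]; exists A, B; split => //; move: tAB;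
  rewrite lt_sqr ?frobenius_ge0.
Qed.

(** Explicit modulus of continuity of the squared norm for entrywise
    perturbations of size at most one. *)
Lemma frobenius_sq_near H e : 0 <= e -> e <= 1 ->
  forall H', (forall i j, `|H' i j - H i j| <= e) ->
  `|sq H' - sq H| <= e * \sum_(c : cell) (2 * `|H c.1 c.2| + 1).
Proof.
move=> e0 e1 H' HH'; rewrite !frobenius_sqE -sumrB mulr_sumr.
apply: le_trans (ler_norm_sum _ _ _) _; apply: ler_sum => c _.
have := HH' c.1 c.2; set x := H' _ _; set y := H _ _ => xy.
rewrite subr_sqr normrM; apply: ler_pM => //.
have -> : x + y = (x - y) + 2 * y by ring.
apply: le_trans (ler_normD _ _) _; rewrite normrM ger0_norm //.
by rewrite addrC lerD2l (le_trans xy).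
Qed.

Lemma frobenius_sq_lt_near H t : sq H < t -> exists2 e, 0 < e &
  forall H', (forall i j, `|H' i j - H i j| <= e) -> sq H' < t.
Proof.
move=> Ht; set L := \sum_(c : cell) (2 * `|H c.1 c.2| + 1).
have L0 : 0 <= L by apply: sumr_ge0 => c _; rewrite addr_ge0 ?mulr_ge0.
have L1 : 0 < L + 1 by rewrite ltr_wpDl.
have em : 0 < Num.min 1 ((t - sq H) / (L + 1)).
  by rewrite lt_min ltr01 divr_gt0 // subr_gt0.
exists (Num.min 1 ((t - sq H) / (L + 1))) => //.
move=> H' HH'; set e := Num.min _ _ in em HH'.
have e1 : e <= 1 by rewrite ge_min lexx.
have eL : e * (L + 1) <= t - sq H.
  by rewrite -ler_pdivlMr // ge_min lexx orbT.
have := frobenius_sq_near (ltW em) e1 HH'; rewrite -/L ler_norml => /andP[].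
nra.
Qed.

Lemma frobenius_sq_gt_near H t : t < sq H -> exists2 e, 0 < e &
  forall H', (forall i j, `|H' i j - H i j| <= e) -> t < sq H'.
Proof.
move=> Ht; set L := \sum_(c : cell) (2 * `|H c.1 c.2| + 1).
have L0 : 0 <= L by apply: sumr_ge0 => c _; rewrite addr_ge0 ?mulr_ge0.
have L1 : 0 < L + 1 by rewrite ltr_wpDl.
have em : 0 < Num.min 1 ((sq H - t) / (L + 1)).
  by rewrite lt_min ltr01 divr_gt0 // subr_gt0.
exists (Num.min 1 ((sq H - t) / (L + 1))) => //.
move=> H' HH'; set e := Num.min _ _ in em HH'.
have e1 : e <= 1 by rewrite ge_min lexx.
have eL : e * (L + 1) <= sq H - t.
  by rewrite -ler_pdivlMr // ge_min lexx orbT.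
have := frobenius_sq_near (ltW em) e1 HH'; rewrite -/L ler_norml => /andP[].
nra.
Qed.

Definition clip (a x : R) : R := Num.max (- a) (Num.min a x).

Lemma clip_bounded a x : 0 <= a -> `|clip a x| <= a.
Proof.
move=> a0; rewrite ler_norml /clip le_max lexx /= ge_max ge_min lexx.
by rewrite (le_trans _ a0) // oppr_le0.
Qed.

Lemma clip_id a x : `|x| <= a -> clip a x = x.
Proof.
by rewrite ler_norml /clip => /andP[h1 h2]; rewrite (min_idPr h2) (max_idPr h1).
Qed.

Lemma clip_near a x y : `|y| <= a -> `|clip a x - y| <= `|x - y|.
Proof.
rewrite ler_norml => /andP[h1 h2]; rewrite /clip /Num.max /Num.min.
by case: (ltP a x) => ax; case: ltP => h; rewrite ler_norml; apply/andP; split;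
  have := ler_norm (x - y); have := ler_norm (- (x - y)); rewrite normrN; lra.
Qed.

(** Truncation keeps the points in the box without destroying density, since
    it is contracting and fixes the box. *)
Definition rational_point (a : R) (Q : 'M[rat]_(m1, m2)) : mx :=
  \matrix_(i, j) clip a (ratr (Q i j)).

Lemma rational_point_bounded a Q : 0 <= a -> `|rational_point a Q| <= a.
Proof.
by move=> a0; apply/(mx_norm_leP _ a0) => i j; rewrite mxE clip_bounded.
Qed.

Lemma rational_point_dense a A e : 0 <= a -> `|A| <= a -> 0 < e ->
  exists Q, forall i j, `|rational_point a Q i j - A i j| <= e.
Proof.
move=> a0 /(mx_norm_leP _ a0) Aa e0.
have /choice[f fP] : forall c : cell, exists q : rat, `|ratr q - A c.1 c.2| <= e.
  move=> c; have : A c.1 c.2 - e < A c.1 c.2 + e by lra.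
  move=> /rat_in_itvoo[q]; rewrite in_itv /= => /andP[h1 h2].
  by exists q; rewrite ler_norml; apply/andP; split; lra.
exists (\matrix_(i, j) f (i, j)) => i j; rewrite !mxE.
exact: le_trans (clip_near _ (Aa i j)) (fP (i, j)).
Qed.

(** Two points of the ball within the box that are more than [t] apart are
    first moved a little towards the centre [M], which keeps them in the
    convex box and puts them strictly inside the ball; then there is room to
    replace them by nearby rational points. The radius is automatically
    positive, as two points are [t] apart. *)
Lemma rational_pair_in_ball a M r t A B : 0 <= a -> 0 <= t ->
  `|M| <= a -> `|A| <= a -> `|B| <= a ->
  sq (A - M) <= r -> sq (B - M) <= r -> t < sq (A - B) ->
  exists Q Q', [/\ sq (rational_point a Q - M) <= r, sq (rational_point a Q' - M) <= r &
    t < sq (rational_point a Q - rational_point a Q')].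
Proof.
move=> a0 t0 Ma Aa Ba Ar Br tAB.
set q := sq (A - B) in tAB.
have q0 : 0 < q by exact: le_lt_trans tAB.
have r0 : 0 < r.
  by have := frobenius_sq_sub_le A B M; rewrite -/q; nra.
(* This step length keeps [(1 - 2 th) q = (q + t) / 2] above [t]. *)
set th := (1 - t / q) / 4.
have tq : t / q < 1 by rewrite ltr_pdivrMr // mul1r.
have tq0 : 0 <= t / q by rewrite divr_ge0 // ltW.
have th0 : 0 < th by rewrite /th; lra.
have th1 : th <= 4^-1 by rewrite /th; lra.
pose sh N := N + th *: (M - N).
have sqZ k H : sq (k *: H) = k ^+ 2 * sq H.
  rewrite !frobenius_sqE mulr_sumr; apply: eq_bigr => c _.
  by rewrite mxE exprMn.
have shM N : sq (N - M) <= r -> sq (sh N - M) < r.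
  have -> : sh N - M = (1 - th) *: (N - M).
    by apply/matrixP => i j; rewrite !mxE; ring.
  rewrite sqZ => Nr; apply: le_lt_trans (ler_wpM2l (sqr_ge0 _) Nr) _.
  by rewrite gtr_pMl //; nra.
have shb N : `|N| <= a -> `|sh N| <= a.
  move=> /(mx_norm_leP _ a0) Na; apply/(mx_norm_leP _ a0) => i j.
  have := Na i j; have /(mx_norm_leP _ a0)/(_ i j) := Ma.
  rewrite !mxE; move: (M i j) (N i j) => x y; rewrite !ler_norml.
  by move=> /andP[x1 x2] /andP[y1 y2]; apply/andP; split; nra.
have shAB : t < sq (sh A - sh B).
  have -> : sh A - sh B = (1 - th) *: (A - B).
    by apply/matrixP => i j; rewrite !mxE; ring.
  rewrite sqZ -/q; have : th * q * 4 = q - t.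
    rewrite /th mulrAC divfK ?mulrBl ?mul1r ?divfK //; exact: lt0r_neq0.
  nra.
have [e1 e10 H1] := frobenius_sq_lt_near (shM _ Ar).
have [e2 e20 H2] := frobenius_sq_lt_near (shM _ Br).
have [e3 e30 H3] := frobenius_sq_gt_near shAB.
set e := Num.min e1 (Num.min e2 (e3 / 2)).
have e0 : 0 < e by rewrite !lt_min e10 e20 divr_gt0.
have ee1 : e <= e1 by rewrite ge_min lexx.
have ee2 : e <= e2 by rewrite !ge_min lexx orbT.
have ee3 : e <= e3 / 2 by rewrite !ge_min lexx !orbT.
have [Q QA] := rational_point_dense a0 (shb _ Aa) e0.
have [Q' QB] := rational_point_dense a0 (shb _ Ba) e0.
exists Q, Q'; split.
- apply/ltW/H1 => i j; have := QA i j; move: (rational_point a Q) (sh A) => G S.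
  by rewrite !mxE opprB addrA addrNK => /le_trans; apply.
- apply/ltW/H2 => i j; have := QB i j; move: (rational_point a Q') (sh B) => G S.
  by rewrite !mxE opprB addrA addrNK => /le_trans; apply.
apply: H3 => i j; have := QA i j; have := QB i j.
move: (rational_point a Q) (rational_point a Q') (sh A) (sh B) => G G' S S'.
rewrite !mxE !ler_norml => /andP[x1 x2] /andP[y1 y2]; apply/andP; split; lra.
Qed.

End Diameter.

(** * Conditioning on the design *)

Section Law.
Local Open Scope ereal_scope.
Context (R : realType) (m1 m2 n : nat) (U sigma : R) (E : experiment R m1 m2 n).
Local Notation cell := ('I_m1 * 'I_m2)%type.
Local Notation mx := 'M[R]_(m1, m2).
Local Notation X := {ffun 'I_n -> cell}.
Local Notation P := (exp_prob E).
Hypotheses (m1_gt0 : (0 < m1)%N) (m2_gt0 : (0 < m2)%N).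
Hypothesis tr : trace_regression U sigma E.
Variable M0 : mx.

(** Once the design is fixed, events on the sample become events on the noise,
    which is independent of the design. *)
Definition sample_at (x : X) (t : n.-tuple R) : n.-tuple (mx * R) :=
  [tuple (delta_mx (x i).1 (x i).2, M0 (x i).1 (x i).2 + tnth t i)%R | i < n].

Lemma measurable_sample_at x : measurable_fun setT (sample_at x).
Proof.
apply/measurable_fun_tnthP => i.
have -> : (@tnth n (mx * R)%type ^~ i) \o sample_at x =
   (fun t => (delta_mx (x i).1 (x i).2, M0 (x i).1 (x i).2 + tnth t i)%R).
  by apply/funext => t /=; rewrite tnth_mktuple.
apply: measurable_fun_pair; first exact: measurable_cst.
by apply: measurable_funD; [exact: measurable_cst|exact: measurable_tnth].
Qed.

Lemma measurable_sample : measurable_fun setT (sample (E := E) M0).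
Proof.
apply/measurable_fun_tnthP => i.
have -> : (@tnth n (mx * R)%type ^~ i) \o sample (E := E) M0 =
   (fun w => (design E i w, response M0 i w)).
  by apply/funext => t /=; rewrite tnth_mktuple.
apply: measurable_fun_pair; first exact: measurable_funP.
apply: measurable_funD; last exact: measurable_funP.
under eq_fun do rewrite mx_innerE.
apply: measurable_sum => c; apply: measurable_funM; last exact: measurable_cst.
apply: (measurableT_comp (measurable_entry c.1 c.2)); exact: measurable_funP.
Qed.

Definition design_event (x : X) : set (exp_space E) :=
  [set w | forall i, design E i w = delta_mx (x i).1 (x i).2].

Lemma sample_design_event x w : design_event x w ->
  sample M0 w = sample_at x (joint (noise E) w).
Proof.
move=> xw; apply: eq_from_tnth => i; rewrite !tnth_mktuple /response xw.
by rewrite mx_innerC mx_inner_delta.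
Qed.

Lemma design_eventE x : design_event x =
  \bigcap_(i in [set` [set: 'I_n]%SET])
    (design E i @^-1` [set delta_mx (x i).1 (x i).2]).
Proof.
apply/seteqP; split => w xw i /=; first by move=> _; exact: xw.
by apply: xw; rewrite /= inE.
Qed.

Lemma measurable_design_event x : measurable (design_event x).
Proof.
rewrite design_eventE; apply: fin_bigcap_measurable => [|i _]; first exact: finite_finset.
by rewrite -[X in measurable X]setTI; apply: measurable_funP => //; exact: measurable_mx1.
Qed.

Lemma trivIset_design_event : trivIset setT design_event.
Proof.
apply/trivIsetP => x y _ _ xy; apply/seteqP; split => // w [/= xw yw].
case/eqP: xy; apply/ffunP => i; apply/eqP.
by rewrite -(delta_mx_cell_inj R) -xw -yw.
Qed.

Let D : R := (m1 * m2)%:R.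

Lemma prob_design_event x : P (design_event x) = (D^-1 ^+ n)%:E.
Proof.
rewrite design_eventE (design_independent tr); last first.
  by move=> i; exact: measurable_mx1.
rewrite (eq_bigr (fun=> D^-1%:E)); last by move=> i _; rewrite (design_uniform tr).
by rewrite prodEFin prodr_const cardsT card_ord.
Qed.

Lemma cell_count_gt0 : (0 < D)%R.
Proof. by rewrite ltr0n muln_gt0 m1_gt0. Qed.

Lemma card_designs : (#|{: X}|%:R = D ^+ n :> R)%R.
Proof. by rewrite card_ffun card_prod !card_ord natrX. Qed.

(** Design and noise are independent, and the design almost surely consists of
    uniformly distributed matrix units. *)
Lemma prob_sample (S : set (n.-tuple (mx * R))) : measurable S ->
  P [set w | S (sample M0 w)] =
  \sum_x (D^-1 ^+ n)%:E * P [set w | S (sample_at x (joint (noise E) w))].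
Proof.
move=> mS; set F := [set w | S (sample M0 w)].
have mF : measurable F.
  by rewrite -[X in measurable X]setTI; exact: measurable_sample.
have mSx x : measurable (sample_at x @^-1` S).
  by rewrite -[X in measurable X]setTI; exact: measurable_sample_at.
set G := \bigcup_(x in [set: X]) design_event x.
have mG : measurable G.
  by apply: fin_bigcup_measurable => // x _; exact: measurable_design_event.
have PG : P G = 1.
  rewrite prob_finite_union; last 2 first.
  - exact: measurable_design_event.
  - exact: trivIset_design_event.
  rewrite (eq_bigr (fun=> (D^-1 ^+ n)%:E)); last by move=> x _; exact: prob_design_event.
  rewrite sumEFin sumr_const -mulr_natl card_designs -exprMn divff ?expr1n //.
  exact/lt0r_neq0/cell_count_gt0.
have PGC : P (~` G) = 0.
  by rewrite probability_setC // PG subee.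
have -> : P F = P (F `&` G).
  have PFG : P (F `\` G) = 0.
    apply/eqP; rewrite eq_le measure_ge0 andbT.
    rewrite -PGC; apply: le_measure => [||w []//]; apply/mem_set.
      exact: measurableD.
    exact: measurableC.
  have mFG : measurable (F `&` G) by exact: measurableI.
  have mFD : measurable (F `\` G) by exact: measurableD.
  have FG0 : (F `&` G) `&` (F `\` G) = set0.
    by apply/seteqP; split => // w [[_ ?] [_]].
  rewrite -{1}(setUIDK F G); apply: etrans (measureU _ mFG mFD FG0) _.
  by apply: etrans (congr1 (fun z => _ + z) PFG) _; rewrite adde0.
have -> : F `&` G = \bigcup_(x in [set: X]) (F `&` design_event x).
  by rewrite setI_bigcupr.
rewrite prob_finite_union; last 2 first.
- by move=> x; apply: measurableI => //; exact: measurable_design_event.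
- exact/trivIset_setIl/trivIset_design_event.
apply: eq_bigr => x _.
pose A := [set v : n.-tuple mx | forall i, tnth v i = delta_mx (x i).1 (x i).2].
have mA : measurable A.
  have -> : A = \bigcap_(i in [set` index_enum 'I_n])
       ((fun v => tnth v i) @^-1` [set delta_mx (x i).1 (x i).2]).
    apply/seteqP; split => v /= vA i; first by move=> _; exact: vA.
    by apply: vA; rewrite /= mem_index_enum.
  rewrite bigcap_seq; apply: bigsetI_measurable => i _.
  rewrite -[X in measurable X]setTI; apply: measurable_tnth => //.
  exact: measurable_mx1.
have AE w : A [tuple design E i w | i < n] <-> design_event x w.
  by split => H i; have := H i; rewrite tnth_mktuple.
have := design_noise_independent tr mA (mSx x).
have -> : [set w | A [tuple design E i w | i < n]] = design_event x.
  by apply/seteqP; split => w /= /AE.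
rewrite prob_design_event => <-; congr (P _); apply/seteqP; split => w /=.
  by move=> [Fw xw]; split; [exact/AE|rewrite -(sample_design_event xw)].
by move=> [/AE xw Sw]; split => //; rewrite /F /= (sample_design_event xw).
Qed.

End Law.

(** * Deviation of the risk estimate and number of pairs *)

Lemma sqr_le_twice_pairs (h : nat) : (1 < h)%N -> (h ^ 2 <= 2 * (h * h.-1))%N.
Proof. by case: h => [|[|k]] //= _; nia. Qed.

Section Concentration.
Context (R : realType) (m1 m2 n : nat) (a U sigma : R) (E : experiment R m1 m2 n).
Local Notation cell := ('I_m1 * 'I_m2)%type.
Local Notation mx := 'M[R]_(m1, m2).
Local Notation X := {ffun 'I_n -> cell}.
Local Notation P := (exp_prob E).
Hypotheses (m1_gt0 : (0 < m1)%N) (m2_gt0 : (0 < m2)%N).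
Hypotheses (a_gt0 : 0 < a) (U_gt0 : 0 < U) (sigma_gt0 : 0 < sigma) (sigma_le : sigma <= U).
Hypothesis n_le : (n <= m1 * m2)%N.
Hypothesis tr : trace_regression U sigma E.
Variables (M0 : mx) (Mhat : half_estimator R m1 m2 n).
Hypotheses (M0_le : `|M0| <= a) (Mhat_le : forall s, `|Mhat s| <= a).

Local Notation I := (first_half n).
Local Notation D := ((m1 * m2)%:R : R).
Local Notation N x := ((pair_total I x)%:R : R).

(** The quantity that the averaged product of residuals estimates. *)
Definition loss (s : n.-tuple (mx * R)) : R :=
  frobenius (M0 - Mhat (second_half s)) ^+ 2 / D.

Let D_pos : 0 < D. Proof. exact: cell_count_gt0. Qed.

Let u := clip U.

Let bu : bounded_measurable u.
Proof.
split; last by exists U => x; apply: clip_bounded; exact: ltW.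
apply: measurable_maxr; first exact: measurable_cst.
by apply: measurable_minr; [exact: measurable_cst|exact: measurable_id].
Qed.

(** Truncating the noise at its almost sure bound changes it on a null set
    only and allows moments to be computed with bounded functions. *)
Lemma noise_clip : {ae P, forall w, forall i, u (noise E i w) = noise E i w}.
Proof.
have := noise_bounded tr; apply: filterS => w H i; exact: clip_id.
Qed.

Lemma mean_clip (f : R -> R) i : bounded_measurable (fun r => f (u r)) ->
  measurable_fun setT f ->
  (\int[P]_w f (u (noise E i w)) = fine (\int[P]_w (f (noise E i w))%:E)%E).
Proof.
move=> bfu mf; rewrite /Rintegral; congr fine.
apply: ae_eq_integral => //.
- apply/measurable_EFinP.
  by have [] := bounded_measurable_comp (@measurable_funP _ _ _ _ setT (noise E i)) bfu.
- by apply/measurable_EFinP; apply: measurableT_comp => //; exact: measurable_funP.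
by have := noise_clip; apply: filterS => w H _; rewrite H.
Qed.

Lemma mean_clip1 i : \int[P]_w u (noise E i w) = 0.
Proof.
rewrite (@mean_clip id _ bu (@measurable_id _ _ _)).
by have := noise_centered tr i; rewrite unlock => ->.
Qed.

Lemma mean_clip2 i : \int[P]_w (u (noise E i w) ^+ 2) = sigma ^+ 2.
Proof.
rewrite (@mean_clip (fun r => r ^+ 2) _ (bounded_measurableX 2 bu)).
  by have := noise_variance tr i; rewrite unlock => ->.
exact: exprn_measurable.
Qed.

Section FixedDesign.
Variable x : X.

Definition gap (t : n.-tuple R) (c : cell) : R :=
  M0 c.1 c.2 - Mhat (second_half (sample_at M0 x t)) c.1 c.2.

Definition centered_gap (t : n.-tuple R) (c : cell) : R :=
  gap t c ^+ 2 - loss (sample_at M0 x t).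

Lemma gap_sq_le t c : gap t c ^+ 2 <= 4 * a ^+ 2.
Proof.
have /(mx_norm_leP _ (ltW a_gt0))/(_ c.1 c.2) := M0_le.
have /(mx_norm_leP _ (ltW a_gt0))/(_ c.1 c.2) := Mhat_le (second_half (sample_at M0 x t)).
rewrite /gap; move: (M0 _ _) (Mhat _ _ _) => p q.
rewrite !ler_norml => /andP[q1 q2] /andP[p1 p2]; nra.
Qed.

Lemma lossE t : loss (sample_at M0 x t) = (\sum_c gap t c ^+ 2) / D.
Proof.
rewrite /loss frobenius_sqE; congr (_ / _); apply: eq_bigr => c _.
by rewrite !mxE.
Qed.

Lemma sum_centered_gap t : \sum_c centered_gap t c = 0.
Proof.
rewrite sumrB sumr_const card_prod !card_ord -mulr_natr lossE divfK ?subrr //.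
exact: lt0r_neq0.
Qed.

(** With squared gaps in [[0, 4 a ^ 2]] of mean [r], the variance is at most
    [4 a ^ 2 r - r ^ 2], which is largest for [r = 2 a ^ 2]. *)
Lemma sum_centered_gap_sq t :
  \sum_c centered_gap t c ^+ 2 <= D * (4 * a ^+ 4).
Proof.
have L := lossE t; set r := loss _ in L.
have -> : \sum_c centered_gap t c ^+ 2 =
    \sum_c (gap t c ^+ 4) - D * r ^+ 2.
  rewrite /centered_gap -/r.
  transitivity (\sum_c (gap t c ^+ 4 - 2 * r * gap t c ^+ 2 + r ^+ 2)).
    by apply: eq_bigr => c _; ring.
  rewrite big_split sumrB -mulr_sumr /= sumr_const card_prod !card_ord -mulr_natl.
  have -> : \sum_c gap t c ^+ 2 = r * D by rewrite L divfK // lt0r_neq0.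
  by ring.
have : \sum_c (gap t c ^+ 4) <= 4 * a ^+ 2 * (r * D).
  rewrite L divfK ?lt0r_neq0 // mulr_sumr; apply: ler_sum => c _.
  rewrite (_ : gap t c ^+ 4 = gap t c ^+ 2 * gap t c ^+ 2); last by ring.
  by rewrite ler_wpM2r ?sqr_ge0 // gap_sq_le.
move=> h; rewrite lerBlDr; apply: le_trans h _.
rewrite -subr_ge0 (_ : _ - _ = D * (2 * a ^+ 2 - r) ^+ 2); last by ring.
by rewrite mulr_ge0 ?sqr_ge0 // ltW.
Qed.

Lemma bounded_measurable_gap c : bounded_measurable (gap ^~ c).
Proof.
apply: bounded_measurableB; first exact: bounded_measurable_cst.
split; last first.
  by exists a => t; move: (Mhat_le (second_half (sample_at M0 x t))) => /(mx_norm_leP _ (ltW a_gt0)).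
apply: (measurableT_comp (measurable_estimate_entry Mhat c.1 c.2)).
exact: measurable_sample_at.
Qed.

Lemma bounded_measurable_centered_gap c : bounded_measurable (centered_gap ^~ c).
Proof.
apply: bounded_measurableB; first exact/bounded_measurableX/bounded_measurable_gap.
under eq_fun do rewrite lossE.
apply: bounded_measurableM; last exact: bounded_measurable_cst.
apply: bounded_measurable_sum => c'; exact/bounded_measurableX/bounded_measurable_gap.
Qed.

(** The estimator, hence the gap, does not depend on the noise of the first
    half. *)
Lemma second_half_erase i t : i \in I ->
  second_half (sample_at M0 x (erase i t)) = second_half (sample_at M0 x t).
Proof.
rewrite inE => ih; apply: second_half_eq => l hl; rewrite !tnth_mktuple.
case: eqP => // li; move: ih; by rewrite -li ltnNge hl.
Qed.

Lemma sample_at_design t : has_design x (sample_at M0 x t).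
Proof. by move=> l; rewrite tnth_mktuple. Qed.

(** Within a pair the product of residuals is [(gap + e) (gap + e')];
    subtracting the loss from [gap ^ 2] leaves the centered gap. *)
Lemma scaled_deviationE t : pair_total I x != 0%N ->
  N x * (Rhat Mhat (sample_at M0 x t) - loss (sample_at M0 x t)) =
  \sum_c centered_gap t c * (pairs_at I x c)%:R +
  \sum_(p <- cell_pairs x)
     (gap t (x p.1) * (tnth t p.1 + tnth t p.2) + tnth t p.1 * tnth t p.2).
Proof.
move=> N0; rewrite /Rhat (sample_pairs_design (sample_at_design t)) size_cell_pairs (negPf N0).
rewrite -(sum_cell_pairs x (centered_gap t)) -big_split /= mulrBr mulrA divff ?pnatr_eq0 // mul1r.
rewrite -size_cell_pairs.
have -> : (size (cell_pairs x))%:R * loss (sample_at M0 x t) =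
    \sum_(p <- cell_pairs x) loss (sample_at M0 x t).
  by rewrite big_const_seq count_predT iter_addr_0 mulr_natl.
rewrite -sumrB; apply: eq_big_seq => p /cell_pairs_mem[_ _ x21].
rewrite /centered_gap /residual !tnth_mktuple /= !mx_inner_delta x21 /gap.
by ring.
Qed.


Definition design_part (t : n.-tuple R) : R :=
  \sum_c centered_gap t c * (pairs_at I x c)%:R.

Lemma bounded_measurable_design_part : bounded_measurable design_part.
Proof.
apply: bounded_measurable_sum => c; apply: bounded_measurableM.
  exact: bounded_measurable_centered_gap.
exact: bounded_measurable_cst.
Qed.

Definition noise_part (t : n.-tuple R) (p : 'I_n * 'I_n) : R :=
  gap t (x p.1) * (u (tnth t p.1) + u (tnth t p.2)) + u (tnth t p.1) * u (tnth t p.2).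

Lemma bounded_measurable_deviation :
  bounded_measurable (fun t => design_part t + \sum_(p <- cell_pairs x) noise_part t p).
Proof.
have be i : bounded_measurable (fun t : n.-tuple R => u (tnth t i)).
  exact: (bounded_measurable_comp (measurable_tnth i)).
apply: bounded_measurableD; first exact: bounded_measurable_design_part.
apply: bounded_measurable_sum => p; apply: bounded_measurableD.
  by apply: bounded_measurableM; [exact: bounded_measurable_gap|exact: bounded_measurableD].
exact: bounded_measurableM.
Qed.

Lemma cell_pairs_half i : i \in pair_indices (cell_pairs x) -> i \in I.
Proof.
move=> /flatten_mapP[p /cell_pairs_mem[+ + _]]; rewrite !inE => h1 h2.
by move=> /orP[] /eqP->.
Qed.

(** Given the design, the noise pairs are orthogonal to the design part and to
    one another. *)
Lemma mean_deviation_sq_le :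
  \int[P]_w ((design_part (joint (noise E) w) +
     \sum_(p <- cell_pairs x) noise_part (joint (noise E) w) p) ^+ 2) <=
  \int[P]_w (design_part (joint (noise E) w) ^+ 2) +
    N x * (8 * a ^+ 2 * U ^+ 2 + U ^+ 4).
Proof.
have halfE i t : i \in pair_indices (cell_pairs x) -> forall c, gap (erase i t) c = gap t c.
  by move=> /cell_pairs_half iI c; rewrite /gap second_half_erase.
have := @mean_pairs_sq _ _ _ P n (noise E) (noise_independent tr) u (sigma ^+ 2) bu
  mean_clip1 mean_clip2 (cell_pairs x) design_part (fun p t => gap t (x p.1))
  (uniq_cell_pairs x) bounded_measurable_design_part
  (fun p => bounded_measurable_gap (x p.1)) _ _.
rewrite /noise_mean => -> //; last 2 first.
- move=> i t iin; apply: eq_bigr => c _; congr (_ * _).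
  rewrite /centered_gap halfE // /loss second_half_erase //.
  exact: cell_pairs_half.
- by move=> p i t iin; rewrite halfE.
have -> : N x * (8 * a ^+ 2 * U ^+ 2 + U ^+ 4) =
    \sum_(p <- cell_pairs x) (8 * a ^+ 2 * U ^+ 2 + U ^+ 4).
  by rewrite big_const_seq count_predT iter_addr_0 size_cell_pairs mulr_natl.
rewrite lerD2l; apply: ler_sum => p _.
set m := \int[P]_w _.
have m_le : m <= 4 * a ^+ 2.
  rewrite -[leRHS](mean_cst P); apply: mean_le.
  - apply: bounded_measurableX.
    exact: (bounded_measurable_joint (noise E) (bounded_measurable_gap (x p.1))).
  - exact: bounded_measurable_cst.
  - by move=> w; exact: gap_sq_le.
have m_ge0 : 0 <= m by apply: Rintegral_ge0 => w _; rewrite sqr_ge0.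
have s2 : sigma ^+ 2 <= U ^+ 2 by rewrite ler_sqr ?nnegrE // ltW.
have s20 : 0 <= sigma ^+ 2 by rewrite sqr_ge0.
rewrite (_ : U ^+ 4 = (U ^+ 2) ^+ 2); last by ring.
apply: lerD; last by rewrite ler_sqr ?nnegrE ?sqr_ge0.
by have := ler_pM s20 m_ge0 s2 m_le; lra.
Qed.

(** The factor, which is the number of pairs, makes the second moment bounded
    by a constant and removes the samples without pairs. *)
Definition scaled_sq_deviation (s : n.-tuple (mx * R)) : R :=
  (size (sample_pairs s))%:R * (Rhat Mhat s - loss s) ^+ 2.

Lemma measurable_scaled_sq_deviation : measurable_fun setT scaled_sq_deviation.
Proof.
apply: measurable_funM; first exact: (@measurable_pairs_number _ _ _ _ (fun k => k%:R)).
apply: measurable_funX; apply: measurable_funB; first exact: measurable_Rhat.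
apply: measurable_funM; last exact: measurable_cst.
exact: measurable_frobenius_estimate.
Qed.

Lemma prob_deviation_fixed theta : 0 < theta ->
  (P [set w | (theta < scaled_sq_deviation (sample_at M0 x (joint (noise E) w)))%R]
   <= (theta^-1 * (8 * a ^+ 2 * U ^+ 2 + U ^+ 4 +
      \int[P]_w (design_part (joint (noise E) w) ^+ 2 / N x)))%:E)%E.
Proof.
move=> th0.
have int_ge0 : 0 <= \int[P]_w (design_part (joint (noise E) w) ^+ 2 / N x).
  by apply: Rintegral_ge0 => w _; rewrite divr_ge0 ?sqr_ge0.
have K0 : 0 <= 8 * a ^+ 2 * U ^+ 2 + U ^+ 4.
  by rewrite addr_ge0 ?mulr_ge0 ?exprn_ge0 ?sqr_ge0 // ltW.
have sz t : size (sample_pairs (sample_at M0 x t)) = pair_total I x.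
  by rewrite (sample_pairs_design (sample_at_design t)) size_cell_pairs.
have [N0|N0] := eqVneq (pair_total I x) 0%N.
  have -> : [set w | theta < scaled_sq_deviation (sample_at M0 x (joint (noise E) w))] = set0.
    apply/seteqP; split => // w /=.
    by rewrite /scaled_sq_deviation sz N0 mul0r ltNge (ltW th0).
  rewrite measure0 lee_fin; apply: mulr_ge0; first by rewrite invr_ge0 ltW.
  exact: addr_ge0.
have Npos : 0 < N x by rewrite ltr0n lt0n.
pose F t := (theta^-1 / N x) * (design_part t + \sum_(p <- cell_pairs x) noise_part t p) ^+ 2.
have bF : bounded_measurable F.
  apply: bounded_measurableM; first exact: bounded_measurable_cst.
  exact/bounded_measurableX/bounded_measurable_deviation.
have bFw := bounded_measurable_joint (noise E) bF.
apply: le_trans (prob_le_mean _ bFw _ _) _.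
- have -> : [set w | theta < scaled_sq_deviation (sample_at M0 x (joint (noise E) w))] =
      joint (noise E) @^-1` (sample_at M0 x @^-1` [set s | theta < scaled_sq_deviation s]) by [].
  rewrite -[X in measurable X]setTI; apply: measurable_joint => //.
  rewrite -[X in measurable X]setTI; apply: measurable_sample_at => //.
  apply: measurable_lt_fun; first exact: measurable_cst.
  exact: measurable_scaled_sq_deviation.
- by move=> w; rewrite mulr_ge0 ?sqr_ge0 // divr_ge0 ?invr_ge0 // ltW.
- have := noise_clip; apply: filterS => w Hw.
  rewrite /= /scaled_sq_deviation sz => lt_th.
  have -> : F (joint (noise E) w) = theta^-1 *
      (N x * (Rhat Mhat (sample_at M0 x (joint (noise E) w)) -
        loss (sample_at M0 x (joint (noise E) w))) ^+ 2).
    have E1 := scaled_deviationE (joint (noise E) w) N0.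
    rewrite /F; have -> : design_part (joint (noise E) w) +
        \sum_(p <- cell_pairs x) noise_part (joint (noise E) w) p =
        N x * (Rhat Mhat (sample_at M0 x (joint (noise E) w)) -
        loss (sample_at M0 x (joint (noise E) w))).
      rewrite E1; congr (_ + _); apply: eq_bigr => p _.
      by rewrite /noise_part !tnth_mktuple !Hw.
    by field; rewrite !lt0r_neq0.
  by rewrite mulrC ler_pdivlMr // mul1r ltW.
rewrite lee_fin /F.
have bD := bounded_measurable_joint (noise E) bounded_measurable_deviation.
rewrite (meanZl P _ (bounded_measurableX 2 bD)) -[leLHS]mulrA ler_pM2l ?invr_gt0 //.
rewrite -(ler_pM2l Npos) mulrA divff ?mul1r ?lt0r_neq0 //.
apply: le_trans mean_deviation_sq_le _.
rewrite [leRHS]mulrDr addrC lerD2l.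
have bDp := bounded_measurable_joint (noise E) bounded_measurable_design_part.
rewrite -(meanZl P (N x)); last first.
  apply: bounded_measurableM; last exact: bounded_measurable_cst.
  exact: bounded_measurableX.
rewrite le_eqVlt; apply/orP; left; apply/eqP; congr Rintegral; apply/funext => w.
by rewrite mulrCA divff ?mulr1 // lt0r_neq0.
Qed.

End FixedDesign.

Lemma second_half_mix x y t :
  second_half (sample_at M0 (mix I x y) t) = second_half (sample_at M0 x t).
Proof.
apply: second_half_eq => l hl; rewrite !tnth_mktuple ffunE inE.
by rewrite ltnNge hl.
Qed.

(** Summing over the designs first, for a fixed noise, the weights depend on
    the second half only, while the counts come from a uniform labelling of
    the first half. *)
Lemma sum_design_part_le t :
  \sum_x (design_part x t ^+ 2 / N x) <= 8 * a ^+ 4 * #|{: X}|%:R.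
Proof.
have cardC : #|{: cell}| = (m1 * m2)%N by rewrite card_prod !card_ord.
apply: le_trans (@sum_centered_mix_le _ _ I R (fun x => centered_gap x t) (4 * a ^+ 4) _ _ _ _ _) _.
- rewrite cardC card_first_half; exact: leq_trans (half_le_self n) n_le.
- by rewrite cardC muln_gt0 m1_gt0.
- move=> x y; apply/funext => c.
  by rewrite /centered_gap /gap /loss second_half_mix.
- by move=> x; exact: sum_centered_gap.
- by move=> x; rewrite cardC; exact: sum_centered_gap_sq.
by rewrite le_eqVlt; apply/orP; left; apply/eqP; ring.
Qed.

Lemma sum_prob_design_le (p : X -> \bar R) (q : X -> R) :
  (forall x, p x <= (q x)%:E)%E ->
  (\sum_x (D^-1 ^+ n)%:E * p x <= ((\sum_x q x) / #|{: X}|%:R)%:E)%E.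
Proof.
move=> pq; rewrite card_designs mulr_suml -sumEFin; apply: lee_sum => x _.
by rewrite mulrC EFinM -exprVn lee_pmul2l // lte_fin exprn_gt0 // invr_gt0.
Qed.

(** Chebyshev's inequality; the constant is reached from [8 a ^ 2 U ^ 2 + U ^
    4] for the noise and [8 a ^ 4] for the design. *)
Lemma prob_deviation theta : 0 < theta ->
  (P [set w | (theta < scaled_sq_deviation (sample M0 w))%R] <=
   ((U ^+ 2 + 4 * a ^+ 2) ^+ 2 / theta)%:E)%E.
Proof.
move=> th0.
have X0 : 0 < #|{: X}|%:R :> R by rewrite card_designs exprn_gt0.
have mS : measurable [set s | theta < scaled_sq_deviation s].
  apply: measurable_lt_fun; first exact: measurable_cst.
  exact: measurable_scaled_sq_deviation.
rewrite (prob_sample m1_gt0 m2_gt0 tr M0 mS).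
apply: le_trans (sum_prob_design_le (fun x => prob_deviation_fixed x th0)) _.
rewrite lee_fin -mulr_sumr big_split /= sumr_const.
rewrite ler_pdivrMr // [leRHS]mulrAC [leRHS]mulrC ler_pM2l ?invr_gt0 //.
have bd x : bounded_measurable (fun t => design_part x t ^+ 2 / N x).
  apply: bounded_measurableM; last exact: bounded_measurable_cst.
  exact/bounded_measurableX/bounded_measurable_design_part.
have bdw x := bounded_measurable_joint (noise E) (bd x).
rewrite -(mean_sum P (index_enum _) bdw).
have : \int[P]_w (\sum_x design_part x (joint (noise E) w) ^+ 2 / N x) <= 8 * a ^+ 4 * #|{: X}|%:R.
  rewrite -[leRHS](mean_cst P); apply: mean_le.
  - exact: bounded_measurable_sum.
  - exact: bounded_measurable_cst.
  - by move=> w; exact: sum_design_part_le.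
move=> h; rewrite -[X in X + _]mulr_natr; apply: (le_trans (lerD (lexx _) h)).
rewrite -mulrDl ler_pM2r //.
have := exprn_ge0 4 (ltW a_gt0).
have -> : (U ^+ 2 + 4 * a ^+ 2) ^+ 2 = 8 * a ^+ 2 * U ^+ 2 + U ^+ 4 + 16 * a ^+ 4 by ring.
by move=> ?; rewrite lerD2l ler_wpM2r // ler_nat.
Qed.

(** Markov's inequality for the inverse of the number of pairs, whose mean is
    bounded by [sum_inv_pair_total_le]. *)
Lemma prob_few_pairs c : 0 < c ->
  (P [set w | ((size (sample_pairs (sample M0 w)))%:R + 1 <= c * (n./2)%:R ^+ 2 / D)%R]
   <= (14 * c)%:E)%E.
Proof.
move=> c0.
have [h0|h0] := posnP n./2.
  have -> : [set w : exp_space E | (size (sample_pairs (sample M0 w)))%:R + 1 <=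
      c * (n./2)%:R ^+ 2 / D] = set0.
    apply/seteqP; split => // w /=; rewrite h0 expr0n /= mulr0 mul0r leNgt ltr_wpDl //.
  by rewrite measure0 lee_fin mulr_ge0 // ltW.
have X0 : 0 < #|{: X}|%:R :> R by rewrite card_designs exprn_gt0.
have mS : measurable [set s : n.-tuple (mx * R) |
    (size (sample_pairs s))%:R + 1 <= c * (n./2)%:R ^+ 2 / D].
  apply: measurable_le_fun; last exact: measurable_cst.
  apply: measurable_funD; last exact: measurable_cst.
  exact: (@measurable_pairs_number _ _ _ _ (fun k => k%:R)).
rewrite (prob_sample m1_gt0 m2_gt0 tr M0 mS).
set H := (n./2)%:R : R.
have H0 : 0 < H by rewrite ltr0n.
pose q (x : X) := (c * H ^+ 2 / D) * (N x + 1)^-1.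
have q0 x : 0 <= q x.
  by rewrite mulr_ge0 ?divr_ge0 ?mulr_ge0 ?sqr_ge0 ?invr_ge0 ?addr_ge0 // ltW.
apply: le_trans (sum_prob_design_le (q := q) _) _.
  move=> x /=.
  have -> : [set w | (size (sample_pairs (sample_at M0 x (joint (noise E) w))))%:R + 1
      <= c * H ^+ 2 / D] = [set _ | N x + 1 <= c * H ^+ 2 / D].
    apply/seteqP; split => w /=;
    by rewrite (sample_pairs_design (sample_at_design _ _)) size_cell_pairs.
  have [le|lt] := boolP (N x + 1 <= c * H ^+ 2 / D).
    apply: le_trans (probability_le1 _ _) _; last first.
      by rewrite lee_fin /q ler_pdivlMr ?mul1r // ltr_wpDl.
    by rewrite set_true; exact: measurableT.
  by rewrite set_false measure0 lee_fin.
rewrite lee_fin ler_pdivrMr // -mulr_sumr.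
have cardC : #|{: cell}| = (m1 * m2)%N by rewrite card_prod !card_ord.
have IC : (#|I| <= #|{: cell}|)%N.
  rewrite cardC card_first_half; exact: leq_trans (half_le_self n) n_le.
suff key : H ^+ 2 * (\sum_(x : X) (N x + 1)^-1) <= 14 * D * #|{: X}|%:R.
  have cD : 0 <= c / D by rewrite divr_ge0 // ltW.
  apply: (@le_trans _ _ (c / D * (14 * D * #|{: X}|%:R))).
    rewrite [leLHS](_ : _ = c / D * (H ^+ 2 * \sum_(x : X) (N x + 1)^-1)); last by ring.
    exact: ler_wpM2l.
  by rewrite le_eqVlt; apply/orP; left; apply/eqP; move: (D) (lt0r_neq0 D_pos) => z z0; field.
have [h1|h2] := leqP n./2 1.
  have -> : H = 1 by rewrite /H (_ : n./2 = 1%N) //; apply/eqP; rewrite eqn_leq h1.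
  rewrite expr1n mul1r; apply: (@le_trans _ _ #|{: X}|%:R).
    rewrite -sum1_card natr_sum; apply: ler_sum => x _.
    by rewrite invf_le1 ?lerDr // ltr_wpDl.
  rewrite -[leLHS]mul1r ler_wpM2r // -natrM ler1n muln_gt0 /=.
  by rewrite muln_gt0 m1_gt0.
have := @sum_inv_pair_total_le _ _ I R IC; rewrite -mulr_suml cardC card_first_half.
move=> h; rewrite mulrC; apply: (@le_trans _ _ (2 * ((\sum_(x : X) (N x + 1)^-1) * (n./2 * (n./2).-1)%:R))).
  rewrite [leRHS]mulrCA ler_wpM2l //; first by apply: sumr_ge0 => x _; rewrite invr_ge0 addr_ge0.
  rewrite /H -natrX -natrM ler_nat.
  exact: sqr_le_twice_pairs.
apply: le_trans (ler_wpM2l _ h) _ => //.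
by rewrite le_eqVlt; apply/orP; left; apply/eqP; ring.
Qed.

End Concentration.

(** * Coverage and diameter of the confidence set *)

Section ConfidenceDiameter.
Context (R : realType) (m1 m2 n : nat) (a U alpha : R).
Local Notation mx := 'M[R]_(m1, m2).
Local Notation samples := (n.-tuple (mx * R)%type).
Hypotheses (m1_gt0 : (0 < m1)%N) (m2_gt0 : (0 < m2)%N) (a_ge0 : 0 <= a).
Variable Mhat : half_estimator R m1 m2 n.
Hypothesis Mhat_le : forall s, `|Mhat s| <= a.

Local Notation D := ((m1 * m2)%:R : R).
Local Notation C := (confidence_set a U alpha Mhat).
Local Notation rho := (radius Mhat a U alpha).

Let D0 : 0 < D. Proof. by rewrite ltr0n muln_gt0 m1_gt0. Qed.

Lemma lt_confidence_diam (s : samples) t : 0 <= t ->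
  t < frobenius_diam (C s) ^+ 2 / D <->
  exists A B, [/\ C s A, C s B & t * D < frobenius (A - B) ^+ 2].
Proof.
move=> t0; rewrite ltr_pdivlMr //.
apply: (@lt_frobenius_diam_sq _ _ _ _ _ (Num.sqrt (4 * a ^+ 2 * D))).
  by rewrite mulr_ge0 // ltW.
move=> A B /confidence_setE[Aa _] /confidence_setE[Ba _].
have h0 : 0 <= 4 * a ^+ 2 * D by rewrite !mulr_ge0.
have := frobenius_sq_box_le a_ge0 Aa Ba; rewrite -{1}(sqr_sqrtr h0).
by rewrite ler_sqr // nnegrE ?frobenius_ge0 ?sqrtr_ge0.
Qed.

(** Two bounds on the squared diameter: the box has diameter at most [2 a]
    entrywise, and the ball of squared radius [rho] gives [4 rho]. *)
Lemma confidence_diam_lt (s : samples) t : 0 <= t ->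
  t < frobenius_diam (C s) ^+ 2 / D -> t < 4 * a ^+ 2 /\ t < 4 * rho s.
Proof.
move=> t0 /(lt_confidence_diam _ t0)[A [B [/confidence_setE[Aa Ar] /confidence_setE[Ba Br] tAB]]].
split; rewrite -(ltr_pM2r D0).
  exact: lt_le_trans tAB (frobenius_sq_box_le a_ge0 Aa Ba).
apply: (lt_le_trans tAB).
have := frobenius_sq_sub_le A B (Mhat (second_half s)).
by move: Ar Br; rewrite !ler_pdivrMr //; lra.
Qed.

(** By [rational_pair_in_ball] it is enough to test the countably many pairs
    of rational points, each of which belongs to the random set on a
    measurable event. *)
Lemma measurable_confidence_diam t : 0 <= t ->
  measurable [set s | t < frobenius_diam (C s) ^+ 2 / D].
Proof.
move=> t0.
pose F (k : nat) : set samples :=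
  if @unpickle ('M[rat]_(m1, m2) * 'M[rat]_(m1, m2))%type k is Some (Q, Q') then
    if t * D < frobenius (rational_point a Q - rational_point a Q') ^+ 2
    then [set s | C s (rational_point a Q)] `&` [set s | C s (rational_point a Q')]
    else set0
  else set0.
have -> : [set s | t < frobenius_diam (C s) ^+ 2 / D] = \bigcup_k F k.
  apply/seteqP; split => s /=.
    move=> /(lt_confidence_diam _ t0)[A [B [/confidence_setE[Aa Ar] /confidence_setE[Ba Br]]]].
    move: Ar Br; rewrite !ler_pdivrMr // => Ar Br tAB.
    have [|Q [Q' [h1 h2 h3]]] := rational_pair_in_ball a_ge0 _ (Mhat_le (second_half s)) Aa Ba Ar Br tAB.
      by rewrite mulr_ge0 // ltW.
    exists (pickle (Q, Q')) => //; rewrite /F pickleK h3; split;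
      by apply/confidence_setE; rewrite ler_pdivrMr //; split => //; exact: rational_point_bounded.
  move=> [k _]; rewrite /F; case: unpickle => // -[Q Q'].
  case: ifPn => // tQ [CQ CQ']; apply/lt_confidence_diam => //.
  by exists (rational_point a Q), (rational_point a Q').
apply: bigcupT_measurable => k; rewrite /F; case: unpickle => [[Q Q']|//].
case: ifPn => // _; apply: measurableI; exact: measurable_coverage.
Qed.

End ConfidenceDiameter.

Lemma leq_mul_sqr_add (p q : nat) : (p * q <= (p + q) ^ 2)%N.
Proof. by nia. Qed.

Section Experiment.
Context (R : realType) (m1 m2 n : nat) (a U alpha sigma : R) (E : experiment R m1 m2 n).
Local Notation mx := 'M[R]_(m1, m2).
Local Notation P := (exp_prob E).
Local Notation D := ((m1 * m2)%:R : R).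
Hypotheses (m1_gt0 : (0 < m1)%N) (m2_gt0 : (0 < m2)%N).
Hypotheses (a_gt0 : 0 < a) (U_gt0 : 0 < U) (alpha_gt0 : 0 < alpha).
Hypotheses (sigma_gt0 : 0 < sigma) (sigma_le : sigma <= U).
Hypothesis n_le : (n <= m1 * m2)%N.
Hypothesis tr : trace_regression U sigma E.
Variables (M0 : mx) (Mhat : half_estimator R m1 m2 n).
Hypotheses (M0_le : `|M0| <= a) (Mhat_le : forall s, `|Mhat s| <= a).

Local Notation C := (confidence_set a U alpha Mhat).
Local Notation rho := (radius Mhat a U alpha).
Local Notation B := (U ^+ 2 + 4 * a ^+ 2).

Let D0 : 0 < D. Proof. exact: cell_count_gt0. Qed.

Let B0 : 0 < B.
Proof. by rewrite addr_gt0 ?mulr_gt0 ?exprn_gt0. Qed.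

Lemma measurable_sample_preimage (S : set (n.-tuple (mx * R))) :
  measurable S -> measurable [set w : exp_space E | S (sample M0 w)].
Proof.
by move=> mS; rewrite -[X in measurable X]setTI; exact: (measurable_sample M0).
Qed.

(** If no pair is available the radius [4 a ^ 2] covers every admissible loss.
    Otherwise a failure means that the loss exceeds the estimate by more than
    [B / sqrt (N alpha)]. *)
Lemma prob_coverage :
  ((1 - alpha)%:E <= P [set w | C (sample M0 w) M0])%E.
Proof.
have mS : measurable [set w : exp_space E | C (sample M0 w) M0].
  exact: (measurable_sample_preimage (measurable_coverage _ _ _ _ _)).
have mT : measurable [set w : exp_space E | B ^+ 2 / alpha <
    scaled_sq_deviation M0 Mhat (sample M0 w)].
  apply: (@measurable_sample_preimage [set s | _ < scaled_sq_deviation M0 Mhat s]).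
  apply: measurable_lt_fun; first exact: measurable_cst.
  exact: measurable_scaled_sq_deviation.
suff : (P (~` [set w | C (sample M0 w) M0]) <= alpha%:E)%E.
  rewrite probability_setC // -(fineK (fin_num_measure P _ mS)) -EFinB !lee_fin.
  by lra.
apply: (@le_trans _ _ (P [set w | B ^+ 2 / alpha <
    scaled_sq_deviation M0 Mhat (sample M0 w)])).
  apply: le_measure => [||w /= nC]; [exact/mem_set/measurableC|exact: mem_set|].
  have : rho (sample M0 w) < loss M0 Mhat (sample M0 w).
    by rewrite ltNge; apply/negP => h; apply/nC/confidence_setE.
  rewrite /radius /zthreshold /scaled_sq_deviation; set s := sample M0 w.
  set k := size _; have [k0|k0] := eqVneq k 0%N.
    rewrite /Rhat -/k k0 /= add0r ltNge ler_pdivrMr //.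
    by rewrite frobenius_sq_box_le // ltW.
  have kp : 0 < k%:R :> R by rewrite ltr0n lt0n.
  rewrite -ltrBrDl => h.
  have sk : 0 < Num.sqrt (k%:R * alpha) by rewrite sqrtr_gt0 mulr_gt0.
  have : (B / Num.sqrt (k%:R * alpha)) ^+ 2 < (loss M0 Mhat s - Rhat Mhat s) ^+ 2.
    by rewrite ltr_sqr ?nnegrE // ?(ltW (lt_trans _ h)) ?divr_gt0 // ltW // divr_gt0.
  rewrite expr_div_n sqr_sqrtr ?mulr_ge0 // ?(ltW alpha_gt0) //.
  rewrite -(ltr_pM2l kp) -(sqrrN (loss _ _ _ - _)) opprB => /(le_lt_trans _); apply.
  by rewrite le_eqVlt; apply/orP; left; apply/eqP; field; rewrite !lt0r_neq0.
apply: le_trans (prob_deviation m1_gt0 m2_gt0 a_gt0 U_gt0 sigma_gt0 sigma_le n_le tr M0_le Mhat_le _) _.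
  by rewrite divr_gt0 // exprn_gt0.
rewrite lee_fin le_eqVlt; apply/orP; left; apply/eqP; field.
by rewrite !lt0r_neq0.
Qed.


(** On this event both the deviation of the estimate from the loss and the
    added threshold are of order [N ^ (-1/2)]. *)
Lemma radius_le_on_good_event (s : n.-tuple (mx * R)) (theta y r : R) : 0 < theta -> 0 < y ->
  loss M0 Mhat s <= r -> y <= (size (sample_pairs s))%:R ->
  scaled_sq_deviation M0 Mhat s <= theta ->
  rho s <= r + (Num.sqrt theta + B / Num.sqrt alpha) / Num.sqrt y.
Proof.
move=> th0 y0 lr; rewrite /radius /zthreshold /scaled_sq_deviation.
set k := size _ => yk dev.
have kp : 0 < k%:R :> R by exact: lt_le_trans yk.
have k0 : k != 0%N by move: kp; rewrite ltr0n lt0n.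
rewrite (negPf k0) sqrtrM // [in leRHS]mulrDl [leRHS]addrA; apply: lerD; last first.
  rewrite invfM mulrA mulrAC ler_wpM2l //.
    by rewrite divr_ge0 ?sqrtr_ge0 // ltW.
  by rewrite lef_pV2 ?posrE ?sqrtr_gt0 // ler_sqrt.
apply: (@le_trans _ _ (loss M0 Mhat s + Num.sqrt theta / Num.sqrt y)); last by rewrite lerD2r.
rewrite -lerBlDl; apply: le_trans (ler_norm _) _.
rewrite ler_pdivlMr ?sqrtr_gt0 // -ler_sqr ?nnegrE ?sqrtr_ge0 ?mulr_ge0 ?sqrtr_ge0 //.
rewrite exprMn real_normK ?num_real // !sqr_sqrtr ?(ltW y0) ?(ltW th0) // mulrC.
by apply: le_trans dev; rewrite ler_wpM2r ?sqr_ge0.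
Qed.

(** Chosen so that [prob_few_pairs] gives probability [alpha' / 4]. *)
Definition pair_fraction (alpha' : R) : R := alpha' / 56.

(** The second and third terms serve the cases in which the rate is bounded
    below, because [m1 + m2] or the expected number of pairs is bounded; the
    bracket serves the main case. *)
Definition diam_constant (C0 alpha' : R) : R :=
  1 + 64 * a ^+ 2 / alpha' + 8 * a ^+ 2 / Num.sqrt (pair_fraction alpha' / 8) +
  (4 * `|C0| + 8 * (Num.sqrt (4 * B ^+ 2 / alpha') + B / Num.sqrt alpha) *
     Num.sqrt (8 / pair_fraction alpha')).

Lemma diam_constant_gt0 (C0 alpha' : R) : 0 < alpha' -> 0 < diam_constant C0 alpha'.
Proof.
move=> al0; have c0 : 0 < pair_fraction alpha' by rewrite divr_gt0.
have K1_ge0 : 0 <= 64 * a ^+ 2 / alpha' by rewrite divr_ge0 ?mulr_ge0 ?sqr_ge0 // ltW.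
have K2_ge0 : 0 <= 8 * a ^+ 2 / Num.sqrt (pair_fraction alpha' / 8).
  by rewrite divr_ge0 // mulr_ge0 // sqr_ge0.
have K3_ge0 : 0 <= 8 * (Num.sqrt (4 * B ^+ 2 / alpha') + B / Num.sqrt alpha) *
    Num.sqrt (8 / pair_fraction alpha').
  apply: mulr_ge0; last exact: sqrtr_ge0.
  apply: mulr_ge0 => //; apply: addr_ge0; first exact: sqrtr_ge0.
  by apply: divr_ge0; [exact: ltW|exact: sqrtr_ge0].
by rewrite /diam_constant; have := normr_ge0 C0; lra.
Qed.

(** If [m1 + m2] or [n ^ 2 / D] is below a constant that depends on [alpha']
    only, the rate is bounded below and the event is empty. Otherwise a large
    diameter requires that the preliminary estimator is inaccurate, that the
    pairs are few, or that the risk estimate deviates, each with probability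
    at most [alpha' / 4]. *)
Lemma prob_large_diam (C0 alpha' : R) (l : nat) : ~~ odd n ->
  (minn m1 m2)%:R * ln (m1 + m2)%:R <= n%:R :> R -> 0 < alpha' -> (1 <= l)%N ->
  ((1 - 2 / (m1 + m2)%:R)%:E <= P [set w | (frobenius (Mhat (second_half (sample M0 w)) - M0) ^+ 2
       / D <= C0 * rate R m1 m2 n l)%R])%E ->
  (P [set w | (diam_constant C0 alpha' * rate R m1 m2 n l <
       frobenius_diam (C (sample M0 w)) ^+ 2 / D)%R] <= alpha'%:E)%E.
Proof.
move=> n_even n_ge al0 l1 prelim.
set d := (m1 + m2)%N in n_ge prelim *.
have d2 : (2 <= d)%N by exact: (leq_add m1_gt0 m2_gt0).
have d0 : 0 < d%:R :> R by rewrite ltr0n ltnW.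
(* Hence the rate is at least [d / (2 n)]. *)
have lnd : 2^-1 <= ln d%:R :> R.
  apply: (@le_trans _ _ (ln 2)); last by rewrite ler_ln ?posrE ?ler_nat.
  have : ln (1 + - 2^-1) <= - 2^-1 :> R by apply: le_ln1Dx; lra.
  have -> : 1 + - 2^-1 = 2^-1 :> R by lra.
  by rewrite lnV ?posrE // lerN2.
have n0 : (0 < n)%N.
  rewrite -(ltr0n R); apply: lt_le_trans n_ge; rewrite mulr_gt0 //.
    by rewrite ltr0n leq_min m1_gt0.
  by apply: lt_le_trans lnd; rewrite invr_gt0.
have n0' : 0 < n%:R :> R by rewrite ltr0n.
have nE : n%:R = 2 * (n./2)%:R :> R.
  by rewrite -natrM mul2n even_halfK.
have Dd : D <= d%:R ^+ 2.
  by rewrite -natrX ler_nat; exact: leq_mul_sqr_add.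
set q := rate R m1 m2 n l.
have q_ge : d%:R / (2 * n%:R) <= q.
  rewrite /q /rate -/d invfM mulrA ler_pM2r ?invr_gt0 //.
  apply: ler_pM => //; rewrite ?invr_ge0 //.
  by rewrite -[leLHS]mul1r ler_wpM2r // ler1n.
have q0 : 0 < q by apply: lt_le_trans q_ge; rewrite divr_gt0 // mulr_gt0.
set c := pair_fraction alpha'.
have c0 : 0 < c by rewrite divr_gt0.
set K := diam_constant C0 alpha'.
pose K1 := 64 * a ^+ 2 / alpha'.
pose K2 := 8 * a ^+ 2 / Num.sqrt (c / 8).
pose K3 := (Num.sqrt (4 * B ^+ 2 / alpha') + B / Num.sqrt alpha) * Num.sqrt (8 / c).
have K1_ge0 : 0 <= K1 by rewrite divr_ge0 ?mulr_ge0 ?sqr_ge0 // ltW.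
have K2_ge0 : 0 <= K2 by rewrite divr_ge0 // mulr_ge0 // sqr_ge0.
have K3_ge0 : 0 <= K3.
  apply: mulr_ge0; last exact: sqrtr_ge0.
  apply: addr_ge0; first exact: sqrtr_ge0.
  by apply: divr_ge0; [exact: ltW|exact: sqrtr_ge0].
have KE : K = 1 + K1 + K2 + (4 * `|C0| + 8 * K3).
  by rewrite /K /diam_constant -/c /K1 /K2 /K3 mulrA.
have cE : c = alpha' / 56 by [].
clearbody c.
have K0 : 0 <= K by rewrite KE; have := normr_ge0 C0; lra.
have Kq0 : 0 <= K * q by rewrite mulr_ge0 // ltW.
have trivial_case : 4 * a ^+ 2 <= K * q ->
    (P [set w | (K * q < frobenius_diam (C (sample M0 w)) ^+ 2 / D)%R] <= alpha'%:E)%E.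
  move=> h; have -> : [set w : exp_space E |
      K * q < frobenius_diam (C (sample M0 w)) ^+ 2 / D] = set0.
    apply/seteqP; split => // w /=.
    move/(confidence_diam_lt m1_gt0 m2_gt0 (ltW a_gt0) Kq0) => [+ _].
    by rewrite ltNge h.
  by rewrite measure0 lee_fin ltW.
(* First case of a rate bounded below: [n <= D <= d ^ 2] and [d] is bounded. *)
have [d_large|d_small] := leP (8 / alpha') d%:R; last first.
  apply: trivial_case; apply: (@le_trans _ _ (K1 * q)); last first.
    by rewrite ler_pM2r // KE; have := normr_ge0 C0; lra.
  have : alpha' / 16 <= q.
    apply: le_trans q_ge; rewrite ler_pdivlMr ?mulr_gt0 //.
    have nd : n%:R <= d%:R ^+ 2 :> R by apply: le_trans Dd; rewrite ler_nat.
    move: d_small; rewrite ltr_pdivlMr // => h.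
    have : alpha' * n%:R <= alpha' * d%:R ^+ 2 by rewrite ler_pM2l.
    have : alpha' * d%:R ^+ 2 <= 8 * d%:R by rewrite expr2 mulrA ler_pM2r // mulrC ltW.
    by lra.
  move=> h; apply: le_trans (ler_wpM2l K1_ge0 h).
  by rewrite le_eqVlt; apply/orP; left; apply/eqP; rewrite /K1; field; rewrite lt0r_neq0.
set H := (n./2)%:R : R in nE.
(* Second case: [n] is at most a constant times the square root of [D], which
   is at most [d]. *)
have [h_large|h_small] := leP 2 (c * H ^+ 2 / D); last first.
  apply: trivial_case; apply: (@le_trans _ _ (K2 * q)); last first.
    by rewrite ler_pM2r // KE; have := normr_ge0 C0; lra.
  have sq8 : 0 < Num.sqrt (c / 8) by rewrite sqrtr_gt0 divr_gt0.
  have : Num.sqrt (c / 8) / 2 <= q.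
    apply: le_trans q_ge; rewrite invfM mulrCA [leLHS]mulrC ler_pM2l ?invr_gt0 //.
    rewrite -ler_sqr ?nnegrE ?sqrtr_ge0 ?divr_ge0 // ?(ltW n0') //.
    rewrite expr_div_n sqr_sqrtr ?divr_ge0 // ?(ltW c0) //.
    rewrite ler_pdivlMr ?exprn_gt0 //; apply: le_trans Dd.
    move: h_small; rewrite ltr_pdivrMr // nE => h; rewrite exprMn.
    by move: h; move: (H ^+ 2) => z; lra.
  move=> h; apply: le_trans (ler_wpM2l K2_ge0 h).
  by rewrite le_eqVlt; apply/orP; left; apply/eqP; rewrite /K2; field; rewrite lt0r_neq0.
(* Main case. Outside an unlikely event the number of pairs exceeds
   [2 y - 1], which is at least [y]. *)
pose y := c * H ^+ 2 / (2 * D).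
have yE : c * H ^+ 2 / D = 2 * y.
  by rewrite /y; move: (D) (lt0r_neq0 D0) => z z0; field.
have y1 : 1 <= y by move: h_large; rewrite yE; lra.
have y0 : 0 < y by apply: lt_le_trans y1.
have sqrty : (Num.sqrt y)^-1 <= 2 * Num.sqrt (8 / c) * q.
  have -> : 2 * Num.sqrt (8 / c) * q = Num.sqrt (8 / c) * (2 * q) by ring.
  apply: (@le_trans _ _ (Num.sqrt (8 / c) * (d%:R / n%:R))); last first.
    rewrite ler_wpM2l ?sqrtr_ge0 //; move: q_ge; rewrite invfM; lra.
  have c8 : 0 <= 8 / c by rewrite divr_ge0 // ltW.
  have yV : 0 <= y^-1 by rewrite invr_ge0 ltW.
  have dn : 0 <= d%:R / n%:R :> R by rewrite divr_ge0.
  rewrite -sqrtrV ?(ltW y0) // -ler_sqr ?nnegrE ?sqrtr_ge0 ?mulr_ge0 ?sqrtr_ge0 //.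
  rewrite exprMn !sqr_sqrtr //.
  have H0 : 0 < H by rewrite -(pmulr_rgt0 _ (ltr0Sn R 1)) -nE.
  rewrite expr_div_n nE /y.
  have -> : (c * H ^+ 2 / (2 * D))^-1 = 8 / c * (D / (2 * H) ^+ 2).
    move: (D) (lt0r_neq0 D0) => z z0; field.
    by rewrite z0 !lt0r_neq0.
  by rewrite ler_pM2l ?divr_gt0 // ler_pM2r // invr_gt0 exprn_gt0 // mulr_gt0.
pose theta := 4 * B ^+ 2 / alpha'.
have th0 : 0 < theta by rewrite divr_gt0 // mulr_gt0 // exprn_gt0.
pose close := [set w : exp_space E | loss M0 Mhat (sample M0 w) <= C0 * q].
pose few := [set w : exp_space E |
  (size (sample_pairs (sample M0 w)))%:R + 1 <= c * H ^+ 2 / D].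
pose deviant := [set w : exp_space E | theta < scaled_sq_deviation M0 Mhat (sample M0 w)].
have mclose : measurable close.
  apply: (@measurable_sample_preimage [set s | loss M0 Mhat s <= C0 * q]).
  apply: measurable_le_fun; last exact: measurable_cst.
  apply: measurable_funM; last exact: measurable_cst.
  exact: measurable_frobenius_estimate.
have mfew : measurable few.
  apply: (@measurable_sample_preimage [set s | (size (sample_pairs s))%:R + 1 <= _]).
  apply: measurable_le_fun; last exact: measurable_cst.
  apply: measurable_funD; last exact: measurable_cst.
  exact: (@measurable_pairs_number _ _ _ _ (fun k => k%:R)).
have mdeviant : measurable deviant.
  apply: (@measurable_sample_preimage [set s | _ < scaled_sq_deviation M0 Mhat s]).
  apply: measurable_lt_fun; first exact: measurable_cst.
  exact: measurable_scaled_sq_deviation.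
have Pclose : (P (~` close) <= (alpha' / 4)%:E)%E.
  rewrite probability_setC //.
  apply: (@le_trans _ _ (2 / d%:R)%:E).
    rewrite -[leRHS](_ : (1 - (1 - 2 / d%:R)%:E)%E = _); last by rewrite -EFinB subKr.
    apply: leeB => //; move: prelim; congr (_ <= P _)%E.
    apply/seteqP; split => w; rewrite /close /loss /=;
    by rewrite frobenius_sq_subC.
  rewrite lee_fin ler_pdivrMr //; move: d_large; rewrite ler_pdivrMr //; lra.
have Pfew : (P few <= (alpha' / 4)%:E)%E.
  apply: le_trans (prob_few_pairs m1_gt0 m2_gt0 n_le tr M0 c0) _.
  by rewrite lee_fin cE; lra.
have Pdeviant : (P deviant <= (alpha' / 4)%:E)%E.
  apply: le_trans (prob_deviation m1_gt0 m2_gt0 a_gt0 U_gt0 sigma_gt0 sigma_le n_le tr M0_le Mhat_le th0) _.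
  rewrite lee_fin le_eqVlt; apply/orP; left; apply/eqP; rewrite /theta; field.
  by rewrite !lt0r_neq0.
have mdiam : measurable [set w : exp_space E |
    K * q < frobenius_diam (C (sample M0 w)) ^+ 2 / D].
  apply: (@measurable_sample_preimage [set s | K * q < frobenius_diam (C s) ^+ 2 / D]).
  exact: (measurable_confidence_diam _ _ m1_gt0 m2_gt0 (ltW a_gt0) Mhat_le Kq0).
have mbad : measurable (~` close `|` few `|` deviant).
  by apply: measurableU => //; apply: measurableU => //; exact: measurableC.
apply: (@le_trans _ _ (P (~` close `|` few `|` deviant))).
  apply: le_measure => [||w /= Kw]; [exact: mem_set|exact: mem_set|].
  apply: contrapT => /not_orP[/not_orP[/contrapT b1 b2] b3].
  have [_] := confidence_diam_lt m1_gt0 m2_gt0 (ltW a_gt0) Kq0 Kw.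
  apply/negP; rewrite -leNgt.
  have yk : y <= (size (sample_pairs (sample M0 w)))%:R.
    by move/negP: b2; rewrite -ltNge yE; move: y1; lra.
  have dev : scaled_sq_deviation M0 Mhat (sample M0 w) <= theta.
    by rewrite leNgt; exact/negP.
  have := radius_le_on_good_event th0 y0 b1 yk dev.
  have C0q : C0 * q <= `|C0| * q by rewrite ler_pM2r // ler_norm.
  set V := Num.sqrt theta + _.
  have V0 : 0 <= V.
    apply: addr_ge0; first exact: sqrtr_ge0.
    by apply: divr_ge0; [exact: ltW|exact: sqrtr_ge0].
  have := ler_wpM2l V0 sqrty.
  have -> : V * (2 * Num.sqrt (8 / c) * q) = 2 * K3 * q by rewrite /K3 -/theta -/V; ring.
  move=> h1 h2; rewrite KE.
  have K1q : 0 <= K1 * q by rewrite mulr_ge0 // ltW.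
  have K2q : 0 <= K2 * q by rewrite mulr_ge0 // ltW.
  have -> : (1 + K1 + K2 + (4 * `|C0| + 8 * K3)) * q =
      q + K1 * q + K2 * q + (4 * (`|C0| * q) + 4 * (2 * K3 * q)) by ring.
  move: h1 h2 C0q K1q K2q q0; move: (V / _) (2 * K3 * q) (K1 * q) (K2 * q) => v1 v2 v3 v4.
  move: (C0 * q) (`|C0| * q) (rho _) => v5 v6 v7; lra.
apply: le_trans (measureU2 _ _ _) _ => //.
  by apply: measurableU => //; exact: measurableC.
apply: (@le_trans _ _ ((alpha' / 4 + alpha' / 4) + alpha' / 4)%:E).
  rewrite !EFinD; apply: leeD => //.
  apply: le_trans (measureU2 _ _ _) _ => //; first exact: measurableC.
  exact: leeD.
by rewrite lee_fin; lra.
Qed.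

End Experiment.

Theorem theorem4p2 (R : realType) (C0 : R -> R -> R) :
  exists K : R -> R -> R -> R -> R,
  forall (alpha a U : R) (m1 m2 n : nat) (Sigma : set R)
         (E : model R m1 m2 n) (Mhat : half_estimator R m1 m2 n),
    0 < alpha -> 0 < a -> 0 < U ->
    (0 < m1)%N -> (0 < m2)%N -> ~~ odd n ->
    Sigma `<=` `]0, U] ->
    (minn m1 m2)%:R * ln (m1 + m2)%:R <= n%:R :> R ->
    (n <= m1 * m2)%N ->
    (forall (M0 : 'M[R]_(m1, m2)) (sigma : R),
       low_rank a (minn m1 m2) M0 -> Sigma sigma ->
       trace_regression U sigma (E M0 sigma)) ->
    preliminary_estimator a (C0 a U) Sigma E Mhat ->
    (forall (M0 : 'M[R]_(m1, m2)) (sigma : R),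
       low_rank a (minn m1 m2) M0 -> Sigma sigma ->
       ((1 - alpha)%:E <=
          exp_prob (E M0 sigma)
            [set w | confidence_set a U alpha Mhat (sample M0 w) M0])%E) /\
    (forall (alpha' : R) (k0 k : nat),
       2 / (m1 + m2)%:R + expR (- (n%:R ^+ 2 / (372 * (m1 * m2)%:R))) < alpha' ->
       (1 <= k0)%N -> (k0 < k)%N -> (k <= minn m1 m2)%N ->
       [/\ honest a alpha k Sigma E (confidence_set a U alpha Mhat),
           0 < K alpha alpha' a U,
           diam_controlled a alpha' (K alpha alpha' a U) k0 Sigma E
             (confidence_set a U alpha Mhat) &
           diam_controlled a alpha' (K alpha alpha' a U) k Sigma E
             (confidence_set a U alpha Mhat)]).
Proof.
exists (fun alpha alpha' a U => diam_constant a U alpha (C0 a U) alpha').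
move=> alpha a U m1 m2 n Sigma E Mhat al0 a0 U0 m10 m20 n_even SU n_ge n_le tr [Mhat_le prelim].
have cover M0 sigma : low_rank a (minn m1 m2) M0 -> Sigma sigma ->
    ((1 - alpha)%:E <= exp_prob (E M0 sigma)
       [set w | confidence_set a U alpha Mhat (sample M0 w) M0])%E.
  move=> LM Ss; have := SU _ Ss; rewrite /= in_itv /= => /andP[s0 sU].
  exact: (prob_coverage m10 m20 a0 U0 al0 s0 sU n_le (tr _ _ LM Ss) LM.1 Mhat_le).
split=> // alpha' k0 k al' k01 k0k km.
have al'0 : 0 < alpha'.
  by apply: le_lt_trans al'; rewrite addr_ge0 ?divr_ge0 ?expR_ge0.
have low l (M0 : 'M[R]_(m1, m2)) : (l <= minn m1 m2)%N -> low_rank a l M0 -> low_rank a (minn m1 m2) M0.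
  by move=> lm [Ma Mr]; split => //; exact: leq_trans lm.
have diam l : (1 <= l <= minn m1 m2)%N ->
    diam_controlled a alpha' (diam_constant a U alpha (C0 a U) alpha') l Sigma E
      (confidence_set a U alpha Mhat).
  move=> /andP[l1 lm]; apply: ge_ereal_sup => _ [[M0 sigma] [/= LM Ss] <-] /=.
  have := SU _ Ss; rewrite /= in_itv /= => /andP[s0 sU].
  have LM' := low _ _ lm LM.
  apply: (prob_large_diam alpha m10 m20 a0 U0 s0 sU n_le (tr _ _ LM' Ss) LM.1 Mhat_le) => //.
  by apply: prelim => //; rewrite l1.
split.
- apply: le_ereal_inf_tmp => _ [[M0 sigma] [/= LM Ss] <-] /=.
  by apply: cover => //; exact: low LM.
- exact: diam_constant_gt0.
- by apply: diam; rewrite k01 (leq_trans (ltnW k0k)).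
- by apply: diam; rewrite km andbT (leq_trans k01 (ltnW k0k)).
Qed.
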